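(* Let $\lambda \in (\frac12, 1)$ be such that $\frac1\lambda$ is a Garsia number, and let $\mathcal S_\lambda = \{\phi_{-1}, \phi_1\}$ be the iterated function system on $\mathbb R$ given by $\phi_{-1}(x) = \lambda x - 1$, $\phi_1(x) = \lambda x + 1$. Then the topological overlap number of $\mathcal S_\lambda$ is $o(\mathcal S_\lambda) = 2\lambda$.
   Context: A Garsia number is an algebraic integer $\gamma\in(1,2)$ whose minimal polynomial has constant coefficient $\pm 2$ and such that $\gamma$ and all of its conjugates have absolute value strictly greater than $1$. Topological overlap number. Let $\mathcal S=\{\phi_i, i\in I\}$ be a finite iterated function system of injective conformal contractions, with limit set $\Lambda$ (the unique nonempty compact set with $\Lambda=\bigcup_{i\in I}\phi_i(\Lambda)$), and write $\phi_{i_1\ldots i_p}=\phi_{i_1}\circ\cdots\circ\phi_{i_p}$. For $\mathcal S_\lambda$, $I=\{-1,1\}$ and $\Lambda=[-\frac1{1-\lambda},\frac1{1-\lambda}]$. Let $\Sigma_I^+=\{\omega=(\omega_1,\omega_2,\ldots):\omega_i\in I\}$ with the shift $\sigma$, and let $\Phi:\Sigma_I^+\times\Lambda\to\Sigma_I^+\times\Lambda$, $\Phi(\omega,x)=(\sigma\omega,\phi_{\omega_1}(x))$, be the lift of $\mathcal S$. Let $\mu_{max}$ be the measure of maximal entropy of $\Phi$ (the equilibrium measure of the zero potential). The topological overlap number $o(\mathcal S)$ is the overlap number of $\mu_{max}$, namely $$o(\mathcal S)=\exp\Big(\lim_{n\to\infty}\frac1n\int_{\Sigma_I^+\times\Lambda}\log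 \mathrm{Card}\{(\eta_1,\ldots,\eta_n)\in I^n:\ \exists y\in\Lambda,\ \phi_{\omega_n\ldots\omega_1}(x)=\phi_{\eta_n\ldots\eta_1}(y)\}\,d\mu_{max}(\omega,x)\Big).$$ It is known that the limit exists and that, equivalently, $o(\mathcal S)=\exp\big(\lim_{n\to\infty}\frac1n\int_{\Sigma_I^+}\log\beta_n(\pi\omega)\,d\mu_{max}^+(\omega)\big)$, where $\beta_n(x)=\mathrm{Card}\{(\eta_1,\ldots,\eta_n)\in I^n: x\in\phi_{\eta_1\ldots\eta_n}(\Lambda)\}$, $\pi:\Sigma_I^+\to\Lambda$, $\pi(\omega)=\phi_{\omega_1\omega_2\ldots}:=\lim_{p\to\infty}\phi_{\omega_1\ldots\omega_p}(z)$ (for any $z\in\Lambda$) is the canonical projection, and $\mu_{max}^+$ is the Bernoulli measure on $\Sigma_I^+$ with weights $(\frac1{|I|},\ldots,\frac1{|I|})$. *)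

(* Defs.v *)
From HB Require Import structures.
From mathcomp Require Import all_boot all_order all_algebra.
From mathcomp Require Import all_classical all_reals all_analysis.
From mathcomp Require Import complex.

Set Implicit Arguments.
Unset Strict Implicit.
Unset Printing Implicit Defensive.

Import Order.TTheory GRing.Theory Num.Theory.
Import numFieldNormedType.Exports.

Local Open Scope classical_set_scope.
Local Open Scope ring_scope.

Section GarsiaNumbers.
Variable R : realType.

Definition is_minimal_polynomial (gamma : R) (p : {poly rat}) : Prop :=
  [/\ p \is monic, root (map_poly ratr p) gamma &
      forall q : {poly rat}, root (map_poly ratr q) gamma -> p %| q].

(* The conjugates of gamma, gamma included, are the complex roots of its
   minimal polynomial over the rationals. *)
Definition garsia_number (gamma : R) : Prop :=
  [/\ 1 < gamma < 2,
      integralOver (intr : int -> R) gamma &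
      exists p : {poly rat},
        [/\ is_minimal_polynomial gamma p,
            p`_0 = 2 \/ p`_0 = - 2 &
            forall z : complex R, root (map_poly ratr p) z -> 1 < `|z|]].

End GarsiaNumbers.

Section Entropy.
Context d (T : measurableType d) (R : realType).

(* A finite partition of T is encoded by its labelling map xi : T -> K: the
   cells are the fibres of xi.  The join of the partitions f^{-i}(xi), i < n,
   is then the partition labelled by [itinerary f xi n]. *)
Definition itinerary (K : finType) (f : T -> T) (xi : T -> K) (n : nat)
    (x : T) : {ffun 'I_n -> K} :=
  [ffun i : 'I_n => xi (iter i f x)].

(* Empty or null cells contribute 0 since ln 0 = 0 in the library. *)
Definition partition_entropy (mu : probability T R) (K : finType)
    (xi : T -> K) : R :=
  - \sum_(a : K) (fine (mu (xi @^-1` [set a])) *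
                  ln (fine (mu (xi @^-1` [set a])))).

Definition dynamical_entropy (mu : probability T R) (f : T -> T)
    (K : finType) (xi : T -> K) : R :=
  limn (fun n : nat => n%:R^-1 * partition_entropy mu (itinerary f xi n)).

(* Kolmogorov-Sinai entropy h_mu(f). *)
Definition measure_entropy (mu : probability T R) (f : T -> T) : \bar R :=
  ereal_sup [set h : \bar R | exists (k : nat) (xi : T -> 'I_k),
    (forall a : 'I_k, measurable (xi @^-1` [set a])) /\
    h = (dynamical_entropy mu f xi)%:E].

Definition invariant_measure (mu : probability T R) (f : T -> T) : Prop :=
  forall A : set T, measurable A -> mu (f @^-1` A) = mu A.

(* f is regarded as a dynamical system on the measurable set X; probability
   measures on X are encoded as probability measures on T carried by X. *)
Definition maximal_entropy_measure (X : set T) (f : T -> T)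
    (mu : probability T R) : Prop :=
  [/\ mu X = 1%E, invariant_measure mu f &
      forall nu : probability T R, nu X = 1%E -> invariant_measure nu f ->
        (measure_entropy nu f <= measure_entropy mu f)%E].

End Entropy.

(* The one-sided symbolic space I^nat; the letter omega_k of the usual
   notation is [omega k.-1]. *)
Definition cylinders (I : Type) : set (set (nat -> I)) :=
  [set C | exists (k : nat) (i : I), C = [set omega | omega k = i]].

Definition symbolic_space (I : pointedType) : Type :=
  g_sigma_algebraType (@cylinders I).

#[short(type="pointedFinType")]
HB.structure Definition PointedFinite := {I of Finite I & Pointed I}.

Section OverlapNumber.
Variables (R : realType) (I : pointedFinType) (phi : I -> R -> R).

Definition is_limit_set (K : set R) : Prop :=
  [/\ K !=set0, compact K & K = \bigcup_(i in [set: I]) (phi i @` K)].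

(* A family of contractions has exactly one limit set, by Hutchinson's
   theorem. *)
Definition limit_set : set R := get is_limit_set.

Local Notation phase_space := (symbolic_space I * R)%type.

Definition ifs_lift (p : phase_space) : phase_space :=
  ((fun k => p.1 k.+1), phi (p.1 0%N) p.2).

Definition lift_domain : set phase_space :=
  [set: symbolic_space I] `*` limit_set.

(* For w = [:: w_1; ...; w_n] this is phi_{w_n ... w_1}(x), the first letter
   being applied first. *)
Definition ifs_iter (w : seq I) (x : R) : R := foldl (fun y i => phi i y) x w.

Definition overlap_count (n : nat) (p : phase_space) : nat :=
  #|[pred eta : n.-tuple I | `[< exists y : R,
      limit_set y /\ ifs_iter (mkseq p.1 n) p.2 = ifs_iter eta y >]]|.

Definition mean_log_overlap
    (mu : probability phase_space R) (n : nat) : R :=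
  n%:R^-1 * \int[mu]_(p in lift_domain) ln (overlap_count n p)%:R.

Definition is_overlap_number
    (mu : probability phase_space R) (o : R) : Prop :=
  exists l : R, mean_log_overlap mu @ \oo --> l /\ o = expR l.

(* [get] denotes the number so defined; it would be 0 if there were no measure
   of maximal entropy or if the averages did not converge, while an actual
   overlap number is positive. *)
Definition topological_overlap_number : R :=
  get [set o : R | exists mu : probability phase_space R,
    maximal_entropy_measure lift_domain ifs_lift mu /\ is_overlap_number mu o].

End OverlapNumber.

HB.instance Definition _ := Pointed.on bool.

(* The index set {-1, 1} is encoded by bool, with true for 1. *)
Definition bernoulli_ifs (R : realType) (lambda : R) (i : bool) (x : R) : R :=
  lambda * x + (if i then 1 else - 1).

(* Main.v *)
From HB Require Import structures.
Require Import Defs.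
From mathcomp Require Import all_boot all_order all_algebra.
From mathcomp Require Import all_classical all_reals all_analysis.
From mathcomp Require Import complex measurable_realfun ring lra.

Set Implicit Arguments.
Unset Strict Implicit.
Unset Printing Implicit Defensive.

Import Order.TTheory GRing.Theory Num.Theory.
Import numFieldNormedType.Exports.

Local Open Scope ring_scope.

(* Let S(w) = phi_w(0) for a word w, and let N_n(z) be the number of words w of
   length n with z in phi_w(Lambda).  The integrand of the n-th average is
   ln N_n evaluated at the second coordinate of Phi^n(omega, x).

   Upper bound.  S(v) - S(w) is, up to the factor 2 lambda^(n-1), the value
   Q(1/lambda) of a polynomial with coefficients in {-1, 0, 1}.  The constant
   coefficient +-2 excludes Q(1/lambda) = 0, and the norm of Q(1/lambda) is a
   nonzero integer, so distinct S(w) are c 2^-n apart (Garsia) and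
   N_n <= C (2 lambda)^n.

   Lower bound.  At most 6 lambda^-n K words w have a point a in phi_w(Lambda)
   with N_n(a) <= K.  When the words of length n are equidistributed, their
   total mass is at most 6 / (n + 1) for K = (2 lambda)^n / (n + 1).

   Equidistribution.  Every Phi-invariant measure satisfies
   h(Phi) <= H(first N letters) / N, because over a fixed word the orbit of x
   moves monotonically with x, so that the position of the orbit with respect
   to finitely many thresholds takes only linearly many values.  The product of
   the fair coin measure and the Bernoulli convolution has entropy ln 2, so a
   measure of maximal entropy gives all words of length n the same mass. *)

(** * Garsia separation *)

(** Both sides are multiplicative in q, which splits into linear factors. For q = X - s the
    determinant is the characteristic polynomial at s up to the sign (-1)^(n+1), and the product
    over [rs] carries the same sign. *)
Lemma det_horner_mx (F : closedFieldType) n (A : 'M[F]_n.+1) (rs : seq F)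
    (q : {poly F}) :
  char_poly A = \prod_(r <- rs) ('X - r%:P) ->
  \det (horner_mx A q) = \prod_(r <- rs) q.[r].
Proof.
move=> Ars.
have szrs : size rs = n.+1.
  by have := size_char_poly A; rewrite Ars size_prod_XsubC => -[].
have [ss ->] := closed_field_poly_normal q.
set l := lead_coef q.
rewrite linearZ /= rmorph_prod /= detZ.
under [RHS]eq_bigr do rewrite hornerZ horner_prod.
rewrite big_split /= big_const_seq count_predT szrs iter_mulr_1.
congr (_ * _).
rewrite exchange_big /= (big_morph _ (@det_mulmx _ _) (det1 _ _)).
apply: eq_bigr => s _.
rewrite rmorphB /= horner_mx_X horner_mx_C -opprB.
have -> : s%:M - A = map_mx (horner_eval s) (char_poly_mx A).
  apply/matrixP => i j; rewrite !mxE /horner_eval !hornerE.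
  by rewrite hornerMn hornerX.
rewrite -scaleN1r detZ det_map_mx -/(char_poly A) Ars.
rewrite -[X in _ * X]/((\prod_(r <- rs) ('X - r%:P)).[s]) horner_prod.
rewrite -szrs -(count_predT rs) -[(-1) ^+ _]iter_mulr_1 -big_const_seq
  -big_split /=.
by apply: eq_bigr => r _; rewrite !hornerE mulN1r opprB.
Qed.

(** The product is the resultant of P and Q; when P is the minimal polynomial of g it is the norm of
    Q(g). *)
Lemma prod_horner_roots_int (F : closedFieldType) (P Q : {poly int})
    (rs : seq F) :
  P \is monic -> map_poly intr P = \prod_(r <- rs) ('X - r%:P) ->
  exists N : int, \prod_(r <- rs) (map_poly intr Q).[r] = N%:~R.
Proof.
move=> mP PE.
move: (companionmx P) (companionmxK mP); case: (size P).-1 => [|n] A AP.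
  have P1 : P = 1 by rewrite -AP /char_poly det_mx00.
  move: PE; rewrite P1 rmorph1; case: rs => [_|r rs /(congr1 (fun p =>
    size (polyseq p)))].
    by exists 1; rewrite big_nil.
  by rewrite size_prod_XsubC size_poly1.
(* A is the companion matrix of P, so the product is the determinant of the
   integer matrix Q(A). *)
exists (\det (horner_mx A Q)).
rewrite -(det_horner_mx (A := map_mx intr A));
  last by rewrite -map_char_poly AP.
by rewrite -map_horner_mx det_map_mx.
Qed.

Lemma ler_norm_horner_int (C : numFieldType) (Q : {poly int}) n (r : C) :
  (size Q <= n)%N -> (forall i, `|Q`_i| <= 1) -> 1 < `|r| ->
  `|(map_poly intr Q).[r]| <= `|r| ^+ n / (`|r| - 1).
Proof.
move=> szQ Q1 r1; have r0 : 0 < `|r| - 1 by rewrite subr_gt0.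
rewrite ler_pdivlMr// (horner_coef_wide _ (leq_trans (size_poly _ _) szQ)).
apply: (@le_trans _ _ ((\sum_(i < n) `|r| ^+ i) * (`|r| - 1))).
  rewrite ler_pM2r//; apply: le_trans (ler_norm_sum _ _ _) _.
  apply: ler_sum => i _; rewrite coef_map normrM normrX -intr_norm.
  by rewrite ler_piMl ?exprn_ge0// lerz1.
by rewrite mulrC -subrX1 lerBlDr lerDl.
Qed.

Section Garsia.
Variables (R : realType) (g : R) (p : {poly rat}).
Hypothesis pmin : is_minimal_polynomial g p.

(** Gauss's lemma: up to a rational scalar, p is an integer factor of a monic integer polynomial
    vanishing at g. The leading coefficient of that factor is a unit of the integers, hence 1 or -1,
    and only a sign has to be corrected. *)
Lemma minimal_polynomial_int : integralOver (intr : int -> R) g ->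
  exists2 P : {poly int}, P \is monic & p = map_poly intr P.
Proof.
case: pmin => mp _ pdvd [q mq rq].
have /dvdpP_rat_int[p1 [a a0 pE]] : p %| map_poly intr q.
  apply: pdvd; rewrite -map_poly_comp (eq_map_poly (g := intr)) // => x /=.
  by rewrite ratr_int.
case=> r qE.
have : lead_coef p1 * lead_coef r = 1 by rewrite -lead_coefM -qE (monicP mq).
move=> /(congr1 absz); rewrite abszM => /eqP; rewrite muln_eq1 => /andP[l2 _].
have {}l2 : (lead_coef p1 == 1) || (lead_coef p1 == -1).
  by case: (lead_coef p1) l2 => [[|[|]]|[|]].
have aE : a * (lead_coef p1)%:~R = 1.
  by have := monicP mp; rewrite pE lead_coefZ lead_coef_map_inj //;
    exact: intr_inj.
exists (lead_coef p1 *: p1).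
  by apply/monicP; rewrite lead_coefZ; case/orP: l2 => /eqP ->.
rewrite pE linearZ /=; congr (_ *: _).
by case/orP: l2 aE => /eqP -> /=; rewrite ?rmorphN ?mulrN mulr1 // => /eqP;
  rewrite eqr_oppLR => /eqP.
Qed.

(** Minimality is stated at g only; it reaches the other conjugates through coprimality. If d =
    gcd(p, q), then g is a root of p / d or of d: the first makes d constant by minimality, the
    second makes g a root of q. A Bezout relation evaluated at r then excludes a common root. *)
Lemma minimal_polynomial_root_neq0 (F : fieldType) (q : {poly rat})
    (f : {rmorphism rat -> F}) (r : F) :
  ~~ root (map_poly ratr q) g -> root (map_poly f p) r ->
    (map_poly f q).[r] != 0.
Proof.
case: pmin => mp rp pdvd qg pr.
have /Bezout_eq1_coprimepP[[u v] /= uv] : coprimep p q.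
  set d := gcdp p q; have dp : d %| p by exact: dvdp_gcdl.
  have dE := divpK dp.
  have d0 : d != 0 by rewrite gcdp_eq0 negb_and monic_neq0.
  move: rp; rewrite -[X in map_poly _ X]dE rmorphM rootM => /orP[/pdvd|] rd.
    have pd0 : p %/ d != 0 by rewrite dvdp_div_eq0 // monic_neq0.
    move: (dvdp_leq pd0 rd); rewrite size_divp // leqNgt ltn_subrL.
    rewrite size_poly_gt0 monic_neq0 // andbT -leqNgt leqn0 /coprimep -/d.
    by move: d0; rewrite -size_poly_gt0; case: (size d) => [|[]].
  case/negP: qg; rewrite -(divpK (dvdp_gcdr p q)) rmorphM rootM.
  by apply/orP; right.
apply/eqP => qr; move/(congr1 (fun x => (map_poly f x).[r])): uv.
rewrite rmorphD !rmorphM/= !hornerE qr (eqP pr) rmorph1 hornerC !mulr0 addr0.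
by move/eqP; rewrite eq_sym oner_eq0.
Qed.

(** Induction on Q strips off factors X until the constant coefficient is nonzero; being of absolute
    value at most 1, it cannot be a multiple of P(0). *)
Lemma minimal_polynomial_small_coef (P Q : {poly int}) :
  P \is monic -> p = map_poly intr P -> g != 0 -> 1 < `|P`_0| ->
  Q != 0 -> (forall i, `|Q`_i| <= 1) ->
  ~~ root (map_poly ratr (map_poly intr Q : {poly rat})) g.
Proof.
move=> mP pE g0 P0; elim/poly_ind: Q => [|Q c IH]; first by rewrite eqxx.
move=> Q0 Q1; apply/negP => Qg.
have [c0|c0] := eqVneq c 0.
  move: Q0 Q1 Qg; rewrite c0 addr0 => Q0 Q1.
  rewrite !rmorphM /= !map_polyX rootM rootX (negPf g0) orbF.
  apply/negP/IH.
    by apply: contraNneq Q0 => ->; rewrite mul0r.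
  by move=> i; have := Q1 i.+1; rewrite coefMX.
(* P divides Q 'X + c over the integers, so c is a multiple of P(0). *)
case: pmin => _ _ /(_ _ Qg); rewrite pE dvdp_rat_int.
case/(Pdiv.IdomainMonic.dvdpP mP) => s /(congr1 (fun x : {poly int} => x`_0)).
rewrite coef0M coefD coefMX coefC /= add0r => cE.
have := Q1 0%N; rewrite coefD coefMX coefC /= add0r cE normrM => /le_gtF/negP.
have : s`_0 != 0 by apply: contraNneq c0 => s0; rewrite cE s0 mul0r.
rewrite -normr_gt0 gtz0_ge1 => s0; apply.
by rewrite (lt_le_trans P0) // ler_peMl.
Qed.

(** The norm of Q(g) is a nonzero integer, so the product of |Q(r)| over all conjugates r is at
    least 1. A conjugate r other than g contributes at most |r|^n / (|r| - 1), and the moduli of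
    these conjugates multiply to 2 / g. What remains is a lower bound for |Q(g)|, with c the product
    of the |r| - 1. *)
Lemma garsia_separation : integralOver (intr : int -> R) g ->
  1 < g -> p`_0 = 2 \/ p`_0 = -2 ->
  (forall z : complex R, root (map_poly ratr p) z -> 1 < `|z|) ->
  exists2 c : R, 0 < c & forall n (Q : {poly int}), Q != 0 -> (size Q <= n)%N ->
    (forall i, `|Q`_i| <= 1) -> c * (g / 2) ^+ n <= `|(map_poly intr Q).[g]|.
Proof.
move=> gint g1 p0 pz.
have [P mP pE] := minimal_polynomial_int gint.
have [rs rsE] := closed_field_poly_normal (map_poly ratr p : {poly complex R}).
have mp : p \is monic by case: pmin.
rewrite lead_coef_map (monicP mp) rmorph1 scale1r in rsE.
have PrsE : map_poly intr P = \prod_(r <- rs) ('X - r%:P).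
  rewrite -rsE pE -map_poly_comp; apply: eq_map_poly => x /=.
  by rewrite ratr_int.
pose gC : complex R := (g%:C)%C.
have rs1 r : r \in rs -> 1 < `|r|.
  by move=> rrs; apply: pz; rewrite rsE root_prod_XsubC.
have grs : gC \in rs.
  rewrite -root_prod_XsubC -rsE.
  have -> : map_poly ratr p = map_poly (real_complex R) (map_poly ratr p).
    rewrite -map_poly_comp; apply: eq_map_poly => x /=; by rewrite fmorph_rat.
  by rewrite /gC fmorph_root; case: pmin.
have normprod : \prod_(r <- rs) `|r| = 2.
  have /(congr1 (fun x => `|x.[0]|)) := rsE.
  rewrite horner_prod normr_prod horner_coef0 coef_map.
  under [RHS]eq_bigr do rewrite !hornerE normrN.
  suff r2 (x : rat) : x = 2 \/ x = -2 -> `|ratr x : complex R| = 2.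
    by move=> <-; apply: r2.
  by case=> ->; rewrite ?rmorphN ?normrN /= (ratr_nat _ 2) normr_nat.
have perm := big_rem _ grs.
pose c := \prod_(r <- rem gC rs) (`|r| - 1).
have rem1 r : r \in rem gC rs -> 1 < `|r| by move/mem_rem/rs1.
have c0 : 0 < c by rewrite /c big_seq; apply: prodr_gt0 => r /rem1;
  rewrite subr_gt0.
(* c is computed among complex numbers; being positive it is real, and its real part serves as the
   witness in R. *)
have cR : ((complex.Re c)%:C)%C = c by apply: RRe_real; apply: gtr0_real.
exists (complex.Re c); first by rewrite -ltcR cR.
move=> n Q Q0 szQ Q1.
have Qg : ~~ root (map_poly ratr (map_poly intr Q : {poly rat})) g.
  apply: (minimal_polynomial_small_coef mP) => //.
    by rewrite gt_eqF // (lt_trans _ g1).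
  move: p0; rewrite pE coef_map /= => -[/eqP|/eqP].
    by rewrite (_ : 2 = 2%:~R) // eqr_int => /eqP ->.
  by rewrite (_ : - 2 = (- 2)%:~R) // eqr_int => /eqP ->.
have [N NE] := prod_horner_roots_int Q mP PrsE.
have QE (r : complex R) : (map_poly intr Q).[r] = (map_poly ratr
  (map_poly intr Q : {poly rat})).[r].
  rewrite -map_poly_comp; congr (_.[_]); apply: eq_map_poly => x /=.
  by rewrite ratr_int.
have N0 : N != 0.
  rewrite -(intr_eq0 (complex R)) -NE prodf_seq_neq0; apply/allP => r rrs /=.
  rewrite QE; apply: minimal_polynomial_root_neq0 => //.
  by rewrite rsE root_prod_XsubC.
have N1 : 1 <= `|(N%:~R : complex R)|.
  by rewrite -intr_norm ler1z -gtz0_ge1 normr_gt0.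
have : c <= `|(map_poly intr Q).[gC]| * (2 / gC) ^+ n.
  have gC0 : 0 < gC by rewrite ltcR (lt_trans _ g1).
  have <- : \prod_(r <- rem gC rs) `|r| = 2 / gC.
    apply: (canRL (mulfK _)); first by rewrite gt_eqF.
    by rewrite -normprod perm /= (gtr0_norm gC0) mulrC.
  rewrite -prodrXl -[c]mul1r -ler_pdivlMr // -mulrA -prodf_div.
  apply: (le_trans N1); rewrite -NE normr_prod perm /= ler_wpM2l //.
  rewrite big_seq [leRHS]big_seq; apply: ler_prod => r /rem1 r1.
  by rewrite normr_ge0 ler_norm_horner_int.
have -> : (map_poly intr Q).[gC] = ((map_poly intr Q).[g]%:C)%C.
  by rewrite -horner_map -map_poly_comp; congr (_.[_]);
    apply: eq_map_poly => x /=; rewrite rmorph_int.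
rewrite -cR (_ : `|_| = (`|(map_poly intr Q).[g]|%:C)%C); last first.
  by rewrite normc_def /= expr0n addr0 sqrtr_sqr.
rewrite (_ : _ ^+ n = (((2 / g) ^+ n)%:C)%C);
  last by rewrite rmorphXn rmorphM fmorphV /= rmorph_nat.
rewrite -rmorphM lecR -ler_pdivrMr ?exprn_gt0 ?divr_gt0 ?(lt_trans _ g1)//.
by rewrite -exprVn invf_div.
Qed.

End Garsia.

(** * Counting words *)

Lemma card_fibers_le (R : realDomainType) (T : finType) (A : {set T})
    (f : T -> nat) (M : nat) (K : R) :
  (forall x, x \in A -> (f x < M)%N) ->
  (forall j, #|[set x in A | f x == j]|%:R <= K) -> #|A|%:R <= M%:R * K.
Proof.
move=> fM fK; case: M fM => [|M] fM.
  rewrite mul0r (_ : A = finset.set0) ?cards0 //.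
  by apply/setP => x; rewrite !inE; apply/negP => /fM.
rewrite -sum1_card (partition_big (fun x => inord (f x) : 'I_M.+1) predT) //=.
rewrite natr_sum; apply: (@le_trans _ _ (\sum_(j < M.+1) K)).
  apply: ler_sum => j _; apply: le_trans (fK j); rewrite sum1_card ler_nat.
  apply: subset_leq_card; apply/fintype.subsetP => x; rewrite !inE => /andP[xA].
  by rewrite -val_eqE /= inordK ?fM// xA.
by rewrite sumr_const card_ord mulr_natl.
Qed.

(** The interval is cut into half-open cells of length d; two values in one cell would be closer
    than d, so every cell holds at most one element. *)
Lemma card_separated_le (R : realType) (T : finType) (A : {set T})
    (f : T -> R) (d a l : R) :
  0 < d -> 0 <= l -> (forall x, x \in A -> a <= f x <= a + l) ->
  (forall x y, x \in A -> y \in A -> x != y -> d <= `|f x - f y|) ->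
  #|A|%:R <= l / d + 1.
Proof.
move=> d0 l0 fal fd; pose c x := Num.trunc ((f x - a) / d).
have cb x : x \in A -> (0 <= (f x - a) / d <= l / d).
  move=> /fal /andP[ax xl]; rewrite divr_ge0 ?subr_ge0 ?(ltW d0) //=.
  by rewrite ler_pM2r ?invr_gt0 // lerBlDl.
apply: (@le_trans _ _ ((Num.trunc (l / d)).+1%:R * 1)); last first.
  by rewrite mulr1 -natr1 lerD2r truncn_le ?divr_ge0 // ltW.
apply: (card_fibers_le (f := c)) => [x xA|j].
  by have /andP[_ ?] := cb _ xA; rewrite ltnS le_truncn.
rewrite lern1; apply/card_le1_eqP => x y.
rewrite !inE => /andP[xA /eqP cx] /andP[yA /eqP cy]; apply/eqP/negPn/negP => xy.
have /andP[x0 _] := cb _ xA; have /andP[y0 _] := cb _ yA.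
have /andP[x1 x2] := truncn_itv x0; have /andP[y1 y2] := truncn_itv y0.
move: x1 x2 y1 y2; rewrite -/(c x) -/(c y) cx cy -natr1 => x1 x2 y1 y2.
have := fd _ _ yA xA xy; rewrite -[f x](subrK a) -[f y](subrK a) opprD addrACA
  subrr addr0.
rewrite -[f y - a](divfK (lt0r_neq0 d0)) -[f x - a](divfK (lt0r_neq0 d0)).
rewrite -mulrBl normrM (gtr0_norm d0) -{1}[d]mul1r ler_pM2r// leNgt => /negP;
  apply.
by rewrite ltr_distlC; lra.
Qed.

Section Words.
Variables (R : realType) (lam : R).
Hypotheses (lam0 : 0 < lam) (lam1 : lam < 1).

Local Notation S := (fun w : seq bool => ifs_iter (bernoulli_ifs lam) w 0).
Let L := (1 - lam)^-1.

Lemma ifs_iter_rcons w b x : ifs_iter (bernoulli_ifs lam) (rcons w b) x =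
  bernoulli_ifs lam b (ifs_iter (bernoulli_ifs lam) w x).
Proof. by rewrite /ifs_iter foldl_rcons. Qed.

Lemma ifs_iter_affine w x :
  ifs_iter (bernoulli_ifs lam) w x = lam ^+ size w * x + S w.
Proof.
elim/last_ind: w => [|w b IH]; first by rewrite /ifs_iter /=; ring.
by rewrite !ifs_iter_rcons IH size_rcons exprS /bernoulli_ifs; ring.
Qed.

(** Rescaling by lambda^-n turns [S w] into a polynomial in 1 / lambda, the number whose conjugates
    are controlled. *)
Lemma word_sumE w : (lam^-1) ^+ size w * S w =
  \sum_(i < size w) lam^-1 ^+ i.+1 * (if nth false w i then 1 else -1).
Proof.
elim/last_ind: w => [|w b IH]; first by rewrite /ifs_iter /= big_ord0 mulr0.
rewrite size_rcons big_ord_recr /= ifs_iter_rcons nth_rcons ltnn eqxx.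
rewrite /bernoulli_ifs mulrDr; congr (_ + _).
rewrite exprSr -mulrA mulKf ?gt_eqF// IH; apply: eq_bigr => i _.
by rewrite nth_rcons ltn_ord.
Qed.

Lemma word_le w : `|S w| <= L.
Proof.
have L0 : 0 < L by rewrite invr_gt0 subr_gt0.
elim/last_ind: w => [|w b IH]; first by rewrite /ifs_iter /= normr0 ltW.
rewrite ifs_iter_rcons /bernoulli_ifs.
apply: (le_trans (ler_normD _ _)); rewrite normrM (gtr0_norm lam0).
have -> : `|if b then 1 else - 1 : R| = 1 by case: b; rewrite ?normrN normr1.
apply: (@le_trans _ _ (lam * L + 1)); first by rewrite lerD2r ler_pM2l.
by rewrite -[X in _ + X](mulfV (lt0r_neq0 L0)) invrK; nra.
Qed.

(** This is N_n(z): the set phi_w(Lambda) is the interval of centre [S w] and radius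
    [lam ^+ n * L]. *)
Definition word_count n (z : R) : nat :=
  #|[set w : n.-tuple bool | `|z - S w| <= lam ^+ n * L]|.

(** [Q] has as coefficients half the differences of the letters, taken as 1 and -1. In the bound of
    [garsia_separation] at g = 1 / lambda the powers of lambda cancel against the rescaling, which
    leaves 2^-n; the factor lambda / 2 is at most 1 and is dropped. *)
Lemma word_separation : garsia_number lam^-1 ->
  exists2 c : R, 0 < c & forall n (v w : n.-tuple bool), v != w ->
    c * 2^-1 ^+ n <= `|S v - S w|.
Proof.
case=> /andP[g1 _] gint [p [pmin p0 pz]].
have [c c0 cQ] := garsia_separation pmin gint g1 p0 pz; exists c => // n v w vw.
pose Q : {poly int} := \poly_(i < n) ((nth false v i)%:Z - (nth false w i)%:Z).
have szQ : (size Q <= n)%N by exact: size_poly.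
have Q0 : Q != 0.
  apply: contraNneq vw => Q0; apply/eqP/val_inj/(@eq_from_nth _ false).
    by rewrite !size_tuple.
  rewrite size_tuple => i ilt; have := congr1 (fun q : {poly int} => q`_i) Q0.
  rewrite coef0 coef_poly ilt => /eqP; rewrite subr_eq0 eqz_nat.
  by case: (nth _ v i); case: (nth _ w i).
have Q1 i : `|Q`_i| <= 1.
  by rewrite coef_poly; case: ifP => // _; case: (nth _ v i); case: (nth _ w i).
have := cQ n Q Q0 szQ Q1.
have -> : (map_poly intr Q).[lam^-1] =
    lam / 2 * lam^-1 ^+ n * (S v - S w).
  have := word_sumE v; have := word_sumE w; rewrite !size_tuple => Ew Ev.
  rewrite -mulrA mulrBr Ev Ew (horner_coef_wide _ (leq_trans
    (size_poly _ _) szQ)).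
  rewrite -sumrB mulr_sumr; apply: eq_bigr => i _.
  rewrite coef_map coef_poly ltn_ord /= exprS -mulrA mulrCA.
  have l0 : lam != 0 by rewrite gt_eqF.
  by case: (nth _ v i); case: (nth _ w i); rewrite /= ?subrr ?sub0r; field.
rewrite normrM (@gtr0_norm _ (lam / 2 * _)) ?mulr_gt0 ?exprn_gt0 ?invr_gt0//.
rewrite exprMn mulrCA [lam / 2 * _]mulrC -mulrA ler_pM2l ?exprn_gt0 ?invr_gt0//
  => h.
apply: (le_trans h); rewrite ler_piMl//; move: lam1; lra.
Qed.

(** The counted values [S w] lie in an interval of length 2 lambda^n L and are c 2^-n apart. The
    extra 1 of the packing bound is absorbed by (2 lambda)^n >= 1. *)
Lemma word_count_le : garsia_number lam^-1 -> 1 <= 2 * lam ->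
  exists2 C : R, 0 < C & forall n z, (word_count n z)%:R <= C * (2 * lam) ^+ n.
Proof.
move=> /word_separation[c c0 sep] lam2.
have L0 : 0 < L by rewrite invr_gt0 subr_gt0.
exists (2 * L / c + 1) => [|n z]; first by
  rewrite ltr_wpDl// ltW// !mulr_gt0// invr_gt0.
have l0 : 0 < lam ^+ n * L by rewrite mulr_gt0 ?exprn_gt0.
have d0 : 0 < c * 2^-1 ^+ n by rewrite mulr_gt0// exprn_gt0.
have := @card_separated_le R _ [set w : n.-tuple bool | `|z - S w| <= lam ^+ n
  * L]
  (fun w => S w) _ (z - lam ^+ n * L) (2 * (lam ^+ n * L)) d0.
rewrite -/(word_count n z) => h.
apply: (le_trans (h _ _ _)); first by rewrite mulr_ge0// ltW.
- by move=> w; rewrite inE ler_distlC => /andP[? ?]; lra.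
- by move=> v w _ _; apply: sep.
rewrite [leRHS]mulrDl mul1r; apply: lerD; last exact: exprn_ege1.
by rewrite exprMn exprVn invfM invrK le_eqVlt; apply/orP; left; apply/eqP; ring.
Qed.

(** The exceptional words of the lower bound: for every other word w, the count exceeds K at all
    points of phi_w(Lambda). *)
Definition sparse_words n (K : R) := [set w : n.-tuple bool |
  `[< exists2 a, `|a - S w| <= lam ^+ n * L & (word_count n a)%:R <= K >]].

(** The point a lies on one of two sides of [S w]. For each side, [-L, L] is cut into cells of
    length l, at most 2 lambda^-n + 1 <= 3 lambda^-n of them, and each cell contains [S w] for at
    most K such words. *)
Lemma card_sparse_words_le n (K : R) : 0 <= K ->
  #|sparse_words n K|%:R <= 6 * (lam ^+ n)^-1 * K.
Proof.
move=> K0; pose l := lam ^+ n * L.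
have L0 : 0 < L by rewrite invr_gt0 subr_gt0.
have l0 : 0 < l by rewrite mulr_gt0 ?exprn_gt0.
pose half (s : bool) := [set w : n.-tuple bool |
  `[< exists2 a, (0 <= (-1) ^+ s * (a - S w) <= l) &
    (word_count n a)%:R <= K >]].
have halfP s : #|half s|%:R <= 3 * (lam ^+ n)^-1 * K.
  pose c (w : n.-tuple bool) := Num.trunc ((S w + L) / l).
  have cb (w : n.-tuple bool) : 0 <= (S w + L) / l <= 2 * (lam ^+ n)^-1.
    have := word_le w; rewrite ler_norml => /andP[w1 w2].
    rewrite divr_ge0 ?(ltW l0) //=; last lra.
    rewrite ler_pdivrMr// /l mulrA mulfVK ?mulrA; last first.
      by rewrite gt_eqF// exprn_gt0.
    lra.
  have nl1 : 1 <= (lam ^+ n)^-1 by rewrite invf_ge1 ?exprn_gt0// exprn_ile1//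
    ltW.
  apply: (@le_trans _ _ ((Num.trunc (2 * (lam ^+ n)^-1)).+1%:R * K));
    last first.
    rewrite ler_wpM2r// -natr1.
    have : (Num.trunc (2 * (lam ^+ n)^-1))%:R <= 2 * (lam ^+ n)^-1.
      by rewrite truncn_le mulr_ge0// ltW// (lt_le_trans _ nl1).
    by move: nl1; lra.
  apply: (card_fibers_le (f := c)) => [w _|j].
    by have /andP[_ ?] := cb w; rewrite ltnS le_truncn.
  set G := [set x in _ | _].
  have [->|[w0 w0G]] := set_0Vmem G; first by rewrite cards0.
  (* w has the extreme value of S within its cell, on the side away from a, so
     a is within l of S v for every other v of that cell. *)
  have [/= w wG wmin] := @arg_minP _ _ _ w0 (mem G) (fun w =>
    (-1) ^+ s * S w) w0G.
  have {}wG : w \in G by [].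
  move: (wG); rewrite /G !inE => /andP[/asboolP[a /andP[a0 al] aK] /eqP cw].
  apply: le_trans aK; rewrite ler_nat subset_leq_card//.
  apply/fintype.subsetP => v vG; have := wmin _ vG.
  move: vG; rewrite /G !inE => /andP[_ /eqP cv] vw.
  have /andP[v0 _] := cb v; have /andP[w00 _] := cb w.
  have /andP[v1 v2] := truncn_itv v0; have /andP[w1 w2] := truncn_itv w00.
  move: v1 v2 w1 w2; rewrite -/(c v) -/(c w) cv cw.
  rewrite ler_pdivlMr// ltr_pdivrMr// ler_pdivlMr// ltr_pdivrMr// -natr1 mulrDl
    => v1 v2 w1 w2.
  rewrite -/l ler_norml; case: (s) a0 al vw => /=;
    rewrite ?expr1 ?expr0 => a0 al vw; apply/andP; split; lra.
have sub : sparse_words n K \subset half false :|: half true.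
  apply/fintype.subsetP => w; rewrite finset.in_setU !finset.in_set =>
    /asboolP[a aw aK].
  have [wa|/ltW wa] := leP (S w) a; apply/orP; [left|right].
    apply/asboolP; exists a => //; rewrite expr0 mul1r subr_ge0 wa.
    by rewrite (le_trans (ler_norm _) aw).
  apply/asboolP; exists a => //; rewrite expr1 mulN1r opprB subr_ge0 wa.
  by rewrite (le_trans (ler_norm _))// distrC.
apply: le_trans (_ : (#|half false| + #|half true|)%:R <= _).
  by rewrite ler_nat (leq_trans (subset_leq_card sub))// leq_card_setU.
rewrite natrD; have := halfP false; have := halfP true; lra.
Qed.

End Words.

Local Open Scope classical_set_scope.

(** * The limit set *)

Section LimitSet.
Variables (R : realType) (lam : R).
Hypotheses (lam_half : 2^-1 < lam) (lam1 : lam < 1).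
Let L := (1 - lam)^-1.
Let phi := bernoulli_ifs lam.

Let lam0 : 0 < lam. Proof. exact: lt_trans lam_half. Qed.

Let L_eq : lam * L + 1 = L.
Proof.
have l1 : 1 - lam != 0 by rewrite subr_eq0 eq_sym lt_eqF.
by apply: (mulfI l1); rewrite mulrDr mulrCA mulfV//; ring.
Qed.

Let exp_small M e : 0 < e -> exists n, lam ^+ n * M < e.
Proof.
move=> e0; have l1 : `|lam| < 1 by rewrite gtr0_norm.
have /cvgr_lt/(_ e e0)[n _ /(_ n (leqnn _))] := @cvg_geometric R M lam l1.
by rewrite /geometric /= mulrC; exists n.
Qed.

Lemma bernoulli_ifs_itv i x : `|x| <= L -> `|phi i x| <= L.
Proof.
rewrite !ler_norml /phi /bernoulli_ifs => /andP[x1 x2].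
have := lam0; have := L_eq; move=> h1 h2; case: i; apply/andP; split; nra.
Qed.

(** The sign of x selects the inverse branch. This works because lambda > 1/2 gives L > 2, that is,
    1 < lambda L, so the two images of the interval overlap around 0. *)
Lemma bernoulli_ifs_cover x : `|x| <= L -> exists i y, `|y| <= L /\ phi i y = x.
Proof.
move=> xL; exists (0 <= x), ((x - (if 0 <= x then 1 else -1)) / lam).
split; last by rewrite /phi /bernoulli_ifs mulrC divfK ?gt_eqF// subrK.
rewrite normrM normfV (gtr0_norm lam0) ler_pdivrMr// [L * _]mulrC.
have L2 : 2 < L by rewrite -[2]invrK ltf_pV2 ?posrE; move: lam_half lam1; lra.
have := L_eq; move: xL; rewrite !ler_norml;
  case: (leP 0 x) => x0 /andP[x1 x2] h;
  apply/andP; split; lra.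
Qed.

Let itv_set := [set x : R | `|x| <= L].

Let itv_setE : itv_set = `[- L, L].
Proof. by rewrite set_itvE; apply/seteqP; split => x;
  rewrite /itv_set /= ler_norml. Qed.

Lemma is_limit_set_itv : is_limit_set phi itv_set.
Proof.
have L0 : 0 < L by rewrite invr_gt0 subr_gt0.
split; first by exists 0; rewrite /itv_set /= normr0 ltW.
  by rewrite itv_setE; exact: segment_compact.
apply/seteqP; split => [x /bernoulli_ifs_cover[i [y [yL <-]]]|x [i _
  [y yL <-]]].
  by exists i => //; exists y.
exact: bernoulli_ifs_itv.
Qed.

(** Both inclusions are contraction arguments. Iterating K = phi_1(K) u phi_-1(K) improves a bound M
    for K to L + lambda^n M for every n. Conversely each point of the interval is within a multiple
    of lambda^n of an image of [k0], and K is closed. *)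
Lemma is_limit_set_uniq K : is_limit_set phi K -> K = itv_set.
Proof.
move=> [[k0 Kk0] cK KE].
have phiK i x : K x -> K (phi i x) by move=> Kx; rewrite KE; exists i => //;
  exists x.
apply/seteqP; split.
  move=> x Kx.
  have [M KM] : exists M, forall x, K x -> `|x| <= M.
    have := compact_bounded cK; rewrite /bounded_set => -[M [_ /(_ (M + 1))]].
    rewrite ltrDl ltr01 => /(_ isT) h; by exists (M + 1) => y /h.
  suff h n : forall y, K y -> `|y| <= L + lam ^+ n * M.
    rewrite /itv_set /= leNgt; apply/negP;
      rewrite -subr_gt0 => /(exp_small M)[n].
    by rewrite ltNge lerBlDl h.
  elim: n => [|n IH] y Ky.
    by rewrite expr0 mul1r (le_trans (KM _ Ky))// lerDr invr_ge0 subr_ge0 ltW.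
  move: Ky; rewrite KE => -[i _ [z /IH zb <-]]; rewrite exprS.
  rewrite -[X in _ <= X + _]L_eq addrAC -mulrA -mulrDr (le_trans
    (ler_normD _ _))//.
  rewrite lerD//; last by case: i; rewrite ?normrN normr1.
  by rewrite normrM gtr0_norm// ler_pM2l.
move=> x xL.
have happrox n : forall x, `|x| <= L -> exists2 k,
  K k & `|x - k| <= lam ^+ n * (L + `|k0|).
  elim: n => [|n IH] y yL.
    by exists k0 => //; rewrite expr0 mul1r (le_trans (ler_normB _ _))// lerD2r.
  have [i [z [/IH[k Kk zk] <-]]] := bernoulli_ifs_cover yL.
  exists (phi i k); first exact: phiK.
  rewrite /phi /bernoulli_ifs (_ : _ - _ = lam * (z - k)); last by ring.
  by rewrite normrM gtr0_norm// exprS -mulrA ler_pM2l.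
have clK : closed K by apply: compact_closed => //; exact: Rhausdorff.
apply: clK => B /nbhs_ballP[e /= e0 eB].
have [n ne] := exp_small (L + `|k0|) e0; have [k Kk xk] := happrox n _ xL.
by exists k; split => //; apply: eB; apply: le_lt_trans ne.
Qed.

Lemma limit_set_bernoulli : limit_set phi = [set x | `|x| <= L].
Proof. by apply: is_limit_set_uniq; apply: (getI is_limit_set_itv). Qed.

End LimitSet.

(** * Entropy of finite labellings *)

Section FiniteEntropy.
Variables (R : realType).

Lemma ln_ltBx1 (x : R) : 0 < x -> x != 1 -> ln x < x - 1.
Proof.
move=> x0 x1; have lx : ln x != 0 by rewrite ln_eq0.
by have := expR_gt1Dx lx; rewrite lnK ?posrE// -ltrBrDl.
Qed.

Lemma ln_leBx1 (x : R) : 0 < x -> ln x <= x - 1.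
Proof.
move=> x0; have [->|x1] := eqVneq x 1; first by rewrite ln1 subrr.
exact/ltW/ln_ltBx1.
Qed.

(** The tangent inequality ln x <= x - 1 at x = q / p, multiplied by p. *)
Lemma gibbs_term (p q : R) : 0 <= p -> 0 <= q -> (0 < p -> 0 < q) ->
  p * ln q - p * ln p <= q - p.
Proof.
rewrite le_eqVlt => /predU1P[<-|p0 q0 /(_ p0) {}q0].
  by rewrite !mul0r subrr subr0.
rewrite -mulrBr -ln_div ?posrE//.
have -> : q - p = p * (q / p - 1) by rewrite mulrBr mulr1 mulrC divfK ?gt_eqF.
by rewrite ler_pM2l// ln_leBx1// divr_gt0.
Qed.

Lemma gibbs_term_lt (p q : R) : 0 <= p -> 0 < q -> p != q ->
  p * ln q - p * ln p < q - p.
Proof.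
rewrite le_eqVlt => /predU1P[<- q0 _|p0 q0 pq].
  by rewrite !mul0r subrr subr0.
rewrite -mulrBr -ln_div ?posrE//.
have -> : q - p = p * (q / p - 1) by rewrite mulrBr mulr1 mulrC divfK ?gt_eqF.
rewrite ltr_pM2l// ln_ltBx1// ?divr_gt0//.
by apply: contraNneq pq => /(canRL (divfK (lt0r_neq0 p0))) ->; rewrite mul1r.
Qed.

Lemma sum_uniform (K : finType) : (0 < #|K|)%N ->
  \sum_(a : K) #|K|%:R^-1 = 1 :> R.
Proof.
by move=> K0; rewrite sumr_const -[LHS]mulr_natl mulfV// pnatr_eq0 -lt0n.
Qed.

Lemma gibbs (K : finType) (p q : K -> R) :
  (forall a, 0 <= p a) -> (forall a, 0 <= q a) -> (forall a, 0 < p a ->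
    0 < q a) ->
  \sum_a q a <= \sum_a p a ->
  - \sum_a p a * ln (p a) <= - \sum_a p a * ln (q a).
Proof.
move=> p0 q0 pq sqp; rewrite lerN2 -subr_ge0 -sumrB -oppr_le0 -sumrN.
apply: (@le_trans _ _ (\sum_a (q a - p a))); last by rewrite sumrB subr_le0.
by apply: ler_sum => a _; rewrite opprB; apply: gibbs_term (pq a).
Qed.

Lemma entropy_le_card (K : finType) (p : K -> R) :
  (forall a, 0 <= p a) -> \sum_a p a = 1 ->
  - \sum_a p a * ln (p a) <= ln #|K|%:R.
Proof.
move=> p0 p1.
have K0 : (0 < #|K|)%N.
  rewrite lt0n; apply/eqP => K0; move: p1; rewrite big1 => [/eqP|a _].
    by rewrite eq_sym oner_eq0.
  by have := fintype0 a K0.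
have := @gibbs K p (fun=> #|K|%:R^-1) p0; rewrite -mulr_suml p1 mul1r.
rewrite lnV ?posrE ?ltr0n// opprK; apply => //.
- by move=> a _; rewrite invr_gt0 ltr0n.
by rewrite sum_uniform.
Qed.

(** The equality case of Gibbs' inequality: one value different from 1 / [#|K|] makes its term
    strict, and then the sum is strict too. *)
Lemma entropy_max_uniform (K : finType) (p : K -> R) :
  (forall a, 0 <= p a) -> \sum_a p a = 1 ->
  ln #|K|%:R <= - \sum_a p a * ln (p a) -> forall a, p a = #|K|%:R^-1.
Proof.
move=> p0 p1 hp a; have K0 : (0 < #|K|)%N by rewrite (cardD1 a).
set q := #|K|%:R^-1; have q0 : 0 < q by rewrite invr_gt0 ltr0n.
apply/eqP/negPn/negP => pa.
have : \sum_b (p b * ln q - p b * ln (p b)) < \sum_b (q - p b).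
  rewrite (bigD1 a)//= [ltRHS](bigD1 a)//= ltr_leD ?gibbs_term_lt//.
  by apply: ler_sum => b _; rewrite gibbs_term// ltW.
rewrite !sumrB p1 -mulr_suml p1 mul1r sum_uniform// subrr lnV ?posrE ?ltr0n//.
by move: hp; lra.
Qed.

End FiniteEntropy.

Definition mlabel d (T : measurableType d) (K : finType) (X : T -> K) :=
  forall a, measurable (X @^-1` [set a]).

Section Labels.
Context d (T : measurableType d) (R : realType) (mu : probability T R).
Implicit Types K : finType.

Lemma mlabel_preimage K (X : T -> K) (Q : set K) :
  mlabel X -> measurable (X @^-1` Q).
Proof.
move=> mX; rewrite [X in measurable X](_ : _ = \bigcup_(a in Q) X @^-1`
  [set a]).
  by apply: fin_bigcup_measurable => //; exact: finite_finset.
by apply/seteqP; split => [p Qp|p [a Qa /= ->]//]; exists (X p).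
Qed.

Lemma mlabel_det K K' (X : T -> K) (Y : T -> K') :
  mlabel Y -> (forall p q, Y p = Y q -> X p = X q) -> mlabel X.
Proof.
move=> mY YX a; rewrite (_ : _ @^-1` _ = Y @^-1` (Y @` (X @^-1` [set a]))).
  exact: mlabel_preimage.
apply/seteqP; split => [p pa|p [q qa /YX]] /=; first by exists p.
by rewrite qa.
Qed.

Lemma mlabel_pair K K' (X : T -> K) (Y : T -> K') :
  mlabel X -> mlabel Y -> mlabel (fun p => (X p, Y p)).
Proof.
move=> mX mY [a b].
rewrite (_ : _ @^-1` _ = X @^-1` [set a] `&` Y @^-1` [set b]).
  exact: measurableI.
by apply/seteqP; split => [p /= [<- <-]|p [/= <- <-]].
Qed.

Lemma mlabel_ffun (I : finType) K (X : I -> T -> K) :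
  (forall i, mlabel (X i)) -> mlabel (fun p => [ffun i => X i p]).
Proof.
move=> mX a.
rewrite (_ : _ @^-1` _ = \bigcap_(i in [set: I]) X i @^-1` [set a i]).
  by apply: fin_bigcap_measurable => [|i _]; [exact: finite_finset|exact: mX].
apply/seteqP; split => [p /= <- i _ /=|p h /=]; first by rewrite ffunE.
by apply/ffunP => i; rewrite ffunE h.
Qed.

Lemma mlabel_comp K (X : T -> K) (f : T -> T) :
  measurable_fun setT f -> mlabel X -> mlabel (X \o f).
Proof. by move=> mf mX a; have := mf measurableT _ (mX a); rewrite setTI. Qed.

Definition label_pr K (X : T -> K) (a : K) : R := fine (mu (X @^-1` [set a])).

Local Notation H := (partition_entropy mu).

Lemma partition_entropyE K (X : T -> K) :
  H X = - \sum_a label_pr X a * ln (label_pr X a).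
Proof. by []. Qed.

Lemma label_pr_ge0 K (X : T -> K) a : 0 <= label_pr X a.
Proof. by rewrite fine_ge0. Qed.

Lemma label_pr_preimage K (X : T -> K) (Q : pred K) : mlabel X ->
  fine (mu (X @^-1` [set a | Q a])) = \sum_(a | Q a) label_pr X a.
Proof.
move=> mX.
have h (r : seq K) : uniq r ->
    fine (mu (X @^-1` [set a | a \in r])) = \sum_(a <- r) label_pr X a.
  elim: r => [_|a r IH /= /andP[ar ur]].
    rewrite big_nil (_ : _ @^-1` _ = set0) ?measure0//.
    by apply/seteqP; split => p //=; rewrite in_nil.
  have mr := mlabel_preimage [set b | b \in r] mX.
  rewrite big_cons -IH// /label_pr -fineD; [|exact: fin_num_measure..].
  rewrite -measureU//; last first.
    by apply/seteqP; split => p //= [->]; rewrite (negPf ar).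
  congr (fine (mu _)); apply/seteqP; split => p /=; rewrite in_cons.
    by case/predU1P; [left|right].
  by case=> [->|->]; rewrite ?eqxx ?orbT.
rewrite -big_enum -h ?enum_uniq//; congr (fine (mu _)).
by apply/seteqP; split => p /=; rewrite mem_enum.
Qed.

Lemma label_pr_comp K K' (Y : T -> K) (g : K -> K') b : mlabel Y ->
  label_pr (g \o Y) b = \sum_(a | g a == b) label_pr Y a.
Proof.
move=> mY; rewrite -label_pr_preimage//; congr (fine (mu _)).
by apply/seteqP; split => p /= /eqP.
Qed.

Lemma label_pr_sum_comp K K' (Y : T -> K) (g : K -> K') (F : K' -> R) :
  mlabel Y ->
  \sum_b label_pr (g \o Y) b * F b = \sum_a label_pr Y a * F (g a).
Proof.
move=> mY; rewrite [RHS](partition_big g predT)//=; apply: eq_bigr => b _.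
by rewrite label_pr_comp// mulr_suml; apply: eq_bigr => a /eqP ->.
Qed.

Lemma label_pr_le_comp K K' (Y : T -> K) (g : K -> K') a : mlabel Y ->
  label_pr Y a <= label_pr (g \o Y) (g a).
Proof.
move=> mY; rewrite label_pr_comp// (bigD1 a)//= lerDl sumr_ge0// => i _.
exact: label_pr_ge0.
Qed.

Lemma label_pr_sum1 K (X : T -> K) : mlabel X -> \sum_a label_pr X a = 1.
Proof.
move=> mX; rewrite -label_pr_preimage//.
by rewrite (_ : _ @^-1` _ = setT) ?probability_setT//; exact/seteqP.
Qed.

Lemma partition_entropy_le_card K (X : T -> K) : mlabel X -> H X <= ln #|K|%:R.
Proof.
move=> mX; rewrite partition_entropyE; apply: entropy_le_card.
  by move=> a; apply: label_pr_ge0.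
exact: label_pr_sum1.
Qed.

Lemma partition_entropy_uniform K (X : T -> K) : mlabel X ->
  ln #|K|%:R <= H X -> forall a, label_pr X a = #|K|%:R^-1.
Proof.
move=> mX; rewrite partition_entropyE; apply: entropy_max_uniform.
  by move=> a; apply: label_pr_ge0.
exact: label_pr_sum1.
Qed.

Lemma partition_entropy_ge0 K (X : T -> K) : mlabel X -> 0 <= H X.
Proof.
move=> mX; rewrite partition_entropyE oppr_ge0; apply: sumr_le0 => a _.
rewrite mulr_ge0_le0 ?label_pr_ge0// ln_le0// -(label_pr_sum1 mX) (bigD1 a)//=.
by rewrite lerDl sumr_ge0// => i _; apply: label_pr_ge0.
Qed.

(** X factors through Y, and a cell of Y has at most the mass of the cell of X that contains it, so
    refining only lowers the logarithms. *)
Lemma partition_entropy_det K K' (X : T -> K) (Y : T -> K') : mlabel Y ->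
  (forall p q, Y p = Y q -> X p = X q) -> H X <= H Y.
Proof.
move=> mY YX; pose g b := X (get (fun p => Y p = b)).
have {YX}-> : X = g \o Y.
  by apply/funext => p; apply/YX/esym/(@getI _ (fun q => Y q = Y p) p).
rewrite !partition_entropyE lerN2 label_pr_sum_comp//; apply: ler_sum => b _.
have := label_pr_ge0 Y b; rewrite le_eqVlt => /predU1P[<-|Yb].
  by rewrite !mul0r.
have gb := @label_pr_le_comp _ _ Y g b mY.
by rewrite ler_pM2l// ler_ln ?posrE// (lt_le_trans Yb).
Qed.

(** Gibbs' inequality between the joint distribution and the product of its marginals. *)
Lemma partition_entropy_pair K K' (X : T -> K) (Y : T -> K') :
  mlabel X -> mlabel Y -> H (fun p => (X p, Y p)) <= H X + H Y.
Proof.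
move=> mX mY; have := mlabel_pair mX mY; set Z := fun p => _ => mZ.
have XZ c : label_pr Z c <= label_pr X c.1 by exact: (label_pr_le_comp
  (@fst K K')).
have YZ c : label_pr Z c <= label_pr Y c.2 by exact: (label_pr_le_comp
  (@snd K K')).
rewrite !partition_entropyE -opprD.
rewrite (@label_pr_sum_comp _ _ Z fst (fun a => ln (label_pr X a)))//.
rewrite (@label_pr_sum_comp _ _ Z snd (fun a => ln (label_pr Y a)))//.
have -> : \sum_c label_pr Z c * ln (label_pr X c.1) +
    \sum_c label_pr Z c * ln (label_pr Y c.2) =
    \sum_c label_pr Z c * ln (label_pr X c.1 * label_pr Y c.2).
  rewrite -big_split /=; apply: eq_bigr => c _; rewrite -mulrDr.
  have := label_pr_ge0 Z c; rewrite le_eqVlt => /predU1P[<-|Zc].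
    by rewrite !mul0r.
  by rewrite lnM// posrE (lt_le_trans Zc).
apply: gibbs.
- by move=> a; apply: label_pr_ge0.
- by move=> a; rewrite mulr_ge0// label_pr_ge0.
- by move=> c Zc; rewrite mulr_gt0// (lt_le_trans Zc).
rewrite (label_pr_sum1 mZ) -(pair_bigA _ (fun a b =>
  label_pr X a * label_pr Y b))/=.
by rewrite -big_distrlr/= !label_pr_sum1// mulr1.
Qed.

Lemma partition_entropy_ffun n K (X : nat -> T -> K) :
  (forall i, mlabel (X i)) ->
  H (fun p => [ffun i : 'I_n => X i p]) <= \sum_(i < n) H (X i).
Proof.
move=> mX; elim: n => [|n IH].
  rewrite big_ord0 (le_trans (partition_entropy_le_card (mlabel_ffun _)))//.
  by rewrite card_ffun card_ord expn0 ln1.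
rewrite big_ord_recr /=; set Z := fun p => [ffun i : 'I_n => X i p].
have mZ : mlabel Z by apply: mlabel_ffun.
apply: (@le_trans _ _ (H (fun p => (Z p, X n p)))); last first.
  by apply: (le_trans (partition_entropy_pair mZ (mX n))); rewrite lerD2r.
apply: partition_entropy_det; first exact: mlabel_pair.
move=> p q [/ffunP Zpq Xpq]; apply/ffunP => i; rewrite !ffunE.
case: (unliftP ord_max i) => [j ->|-> //].
by have := Zpq j; rewrite !ffunE lift_max.
Qed.

End Labels.

(** * Entropy of itineraries under an invariant measure *)

Section Itineraries.
Context d (T : measurableType d) (R : realType) (mu : probability T R).
Variable (f : T -> T).
Hypotheses (mf : measurable_fun setT f) (finv : invariant_measure mu f).
Implicit Types K : finType.

Local Notation H := (partition_entropy mu).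

Lemma mlabel_iter K (X : T -> K) i : mlabel X -> mlabel (X \o iter i f).
Proof.
move=> mX; elim: i => [|i IH]; first exact: mX.
have -> : X \o iter i.+1 f = (X \o iter i f) \o f.
  by apply/funext => p /=; rewrite -iterS iterSr.
exact: mlabel_comp.
Qed.

Lemma mlabel_itinerary K (X : T -> K) n : mlabel X -> mlabel (itinerary f X n).
Proof. by move=> mX; apply: mlabel_ffun => i; apply: mlabel_iter. Qed.

Lemma partition_entropy_iter K (X : T -> K) i : mlabel X ->
  H (X \o iter i f) = H X.
Proof.
move=> mX; elim: i => [//|i <-].
rewrite !partition_entropyE; congr (- _); apply: eq_bigr => a _.
suff -> : label_pr mu (X \o iter i.+1 f) a = label_pr mu (X \o iter i f) a by
  [].
rewrite /label_pr -[in RHS]finv; last exact: mlabel_iter.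
by congr (fine (mu _)); apply/seteqP; split => p /=; rewrite -iterS iterSr.
Qed.

Lemma partition_entropy_itinerary K (X : T -> K) n : mlabel X ->
  H (itinerary f X n) <= n%:R * H X.
Proof.
move=> mX.
apply: (@le_trans _ _ (\sum_(i < n) H (X \o iter i f))).
  apply: (@partition_entropy_ffun _ _ _ mu n K (fun i => X \o iter i f)) => i.
  exact: mlabel_iter.
under eq_bigr do rewrite partition_entropy_iter//.
by rewrite sumr_const card_ord mulr_natl.
Qed.

(** The times below n are covered by [n %/ N + 1] consecutive blocks of length N, all of the same
    entropy by invariance. *)
Lemma partition_entropy_itinerary_block K (X : T -> K) n N : mlabel X ->
  (0 < N)%N ->
  H (itinerary f X n) <= (n%:R / N%:R + 1) * H (itinerary f X N).
Proof.
move=> mX N0; pose k := (n %/ N).+1.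
pose Y i : T -> {ffun 'I_N -> K} := itinerary f X N \o iter (i * N) f.
have mY i : mlabel (Y i) by apply/mlabel_iter/mlabel_itinerary.
apply: (@le_trans _ _ (H (fun p => [ffun i : 'I_k => Y i p]))).
  apply: partition_entropy_det; first exact: mlabel_ffun.
  move=> p q /ffunP Ypq; apply/ffunP => i; rewrite !ffunE.
  have ik : (i %/ N < k)%N by rewrite ltnS leq_div2r// ltnW.
  have iN : (i %% N < N)%N by rewrite ltn_mod.
  have := Ypq (Ordinal ik); rewrite !ffunE => /ffunP /(_ (Ordinal iN)).
  by rewrite !ffunE /= -!iterD addnC -divn_eq.
apply: (@le_trans _ _ (\sum_(i < k) H (Y i))).
  exact: partition_entropy_ffun.
rewrite (eq_bigr (fun=> H (itinerary f X N))) => [|i _]; last first.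
  by apply: partition_entropy_iter; exact: mlabel_itinerary.
rewrite sumr_const card_ord -[leLHS]mulr_natl ler_wpM2r//.
  exact/partition_entropy_ge0/mlabel_itinerary.
rewrite -natr1 lerD2r ler_pdivlMr ?ltr0n// -natrM ler_nat.
exact: leq_trunc_div.
Qed.

(** The label keeps X only where Z is wrong, so its entropy is small when Z is a good approximation,
    while Z and the error together still determine X. *)
Definition label_error (K : eqType) (X Z : T -> K) (p : T) : option K :=
  if X p == Z p then None else Some (X p).

Lemma mlabel_error K (X Z : T -> K) : mlabel X -> mlabel Z ->
  mlabel (label_error X Z).
Proof.
move=> mX mZ; apply: (mlabel_det (mlabel_pair mX mZ)) => p q [].
by rewrite /label_error => -> ->.
Qed.

Lemma partition_entropy_itinerary_error K (X Z : T -> K) n :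
  mlabel X -> mlabel Z ->
  H (itinerary f X n) <= H (itinerary f Z n) + n%:R * H (label_error X Z).
Proof.
move=> mX mZ; have mE := mlabel_error mX mZ.
(* X is recovered from Z and the error label. *)
pose W p := (itinerary f Z n p, itinerary f (label_error X Z) n p).
apply: (@le_trans _ _ (H W)).
  apply: partition_entropy_det; first by apply: mlabel_pair;
    apply: mlabel_itinerary.
  move=> p q [/ffunP Zpq /ffunP Epq]; apply/ffunP => i.
  move: (Zpq i) (Epq i); rewrite !ffunE /label_error.
  by do 2![case: eqP => [->|_]] => // _ [].
apply: le_trans (partition_entropy_pair _ _ _) _; [exact: mlabel_itinerary..|].
by rewrite lerD2l partition_entropy_itinerary.
Qed.

(** With s = sqrt x the left side is 2 s (s * - ln s), and - ln s <= 1 / s - 1. This is an explicit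
    modulus of continuity of x ln x at 0. *)
Lemma entropy_term_le (x : R) : 0 <= x -> x <= 1 ->
  - (x * ln x) <= 2 * Num.sqrt x.
Proof.
rewrite le_eqVlt => /predU1P[<- _|x0 x1];
  first by rewrite mul0r oppr0 sqrtr0 mulr0.
set s := Num.sqrt x; have s0 : 0 < s by rewrite sqrtr_gt0.
have xE : x = s ^+ 2 by rewrite sqr_sqrtr// ltW.
have : ln s^-1 <= s^-1 - 1 by rewrite ln_leBx1// invr_gt0.
rewrite lnV ?posrE// => h.
have lx : ln x = 2 * ln s by rewrite xE expr2 lnM ?posrE//; ring.
rewrite lx {1}xE (_ : - _ = 2 * s * (s * - ln s)); last by ring.
rewrite -[leRHS]mulr1 ler_pM2l ?mulr_gt0//.
rewrite -[leRHS](mulfV (lt0r_neq0 s0)) ler_pM2l//; lra.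
Qed.

Lemma partition_entropy_error_small K (X : T -> K) e : mlabel X -> 0 < e ->
  exists2 dl, 0 < dl & forall Z : T -> K, mlabel Z ->
    fine (mu [set p | X p <> Z p]) <= dl -> H (label_error X Z) <= e.
Proof.
(* If the error has mass dl, the cell [None] contributes at most dl <= sqrt dl and each of the
   [#|K|] other cells at most 2 sqrt dl; c collects these factors of sqrt dl. *)
move=> mX e0; pose c : R := 1 + 2 * #|K|%:R.
have c0 : 0 < c by rewrite ltr_wpDr.
exists ((e / c) ^+ 2) => [|Z mZ]; first by rewrite exprn_gt0// divr_gt0.
have mE := mlabel_error mX mZ; set E := label_error X Z in mE *.
have -> : fine (mu [set p | X p <> Z p]) = \sum_(a | a != None) label_pr mu E a.
  rewrite -label_pr_preimage//; congr (fine (mu _)).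
  apply/seteqP; split => p /=; rewrite /E /label_error.
    by case: (X p =P Z p) => // XZ /(_ XZ).
  by case: (X p =P Z p) => //; rewrite eqxx.
set dl := \sum_(_ | _) _ => dle.
have dl0 : 0 <= dl by apply: sumr_ge0 => a _; apply: label_pr_ge0.
have p1 : label_pr mu E None + dl = 1.
  by rewrite -(label_pr_sum1 mu mE) [RHS](bigD1 None).
have dl1 : dl <= 1 by rewrite -p1 lerDr label_pr_ge0.
have sdl : Num.sqrt dl <= e / c.
  rewrite -[leRHS]ger0_norm; last by rewrite divr_ge0// ltW.
  by rewrite -sqrtr_sqr ler_wsqrtr.
have dls : dl <= Num.sqrt dl.
  have s1 : Num.sqrt dl <= 1 by rewrite -sqrtr1 ler_wsqrtr.
  by rewrite -[leLHS](sqr_sqrtr dl0) expr2 ler_piMl ?sqrtr_ge0.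
rewrite partition_entropyE (bigD1 None)//= opprD -sumrN.
apply: (@le_trans _ _ (Num.sqrt dl + \sum_(a : option K | a != None) 2 *
  Num.sqrt dl)).
  apply: lerD; last first.
    apply: ler_sum => a a0.
    have adl : label_pr mu E a <= dl.
      by rewrite /dl (bigD1 a)//= lerDl sumr_ge0// => i _; apply: label_pr_ge0.
    apply: (le_trans (entropy_term_le (label_pr_ge0 _ _ _) _)).
      exact: le_trans dl1.
    by rewrite ler_pM2l// ler_wsqrtr.
  apply: le_trans dls; set p := label_pr mu E None in p1 *.
  have p0 : 0 <= p by apply: label_pr_ge0.
  have := gibbs_term p0 ler01 (fun=> ltr01); rewrite ln1 mulr0 sub0r.
  by move: p1; lra.
rewrite sumr_const -mulr_natl.
have -> : #|[pred a : option K | a != None]| = #|K|.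
  by rewrite (cardC1 None) card_option.
apply: (@le_trans _ _ (c * Num.sqrt dl)); first by rewrite /c le_eqVlt;
  apply/orP; left; apply/eqP; ring.
by rewrite mulrC -ler_pdivlMr.
Qed.

End Itineraries.

(** * Approximation of measurable sets by an algebra of sets *)

Section Approximation.
Context d (T : measurableType d) (R : realType) (mu : probability T R).
Variable G : set (set T).
Hypotheses (Gm : G `<=` measurable) (GC : setC_closed G) (GU : setU_closed G)
  (G0 : G set0).

Local Notation m A := (fine (mu A)).
Local Notation "A `+ B" := ((A `\` B) `|` (B `\` A)) (at level 52,
  left associativity).

Lemma fine_measure_leU A B C : measurable A -> measurable B -> measurable C ->
  A `<=` B `|` C -> m A <= m B + m C.
Proof.
move=> mA mB mC ABC; rewrite -fineD ?fin_num_measure// fine_le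
  ?fin_num_measure//.
  by rewrite fin_numD !fin_num_measure.
apply: (le_trans _ (measureU2 _ _ _)) => //.
by apply: le_measure; rewrite ?inE//; apply: measurableU.
Qed.

Definition approximable (E : set T) := measurable E /\
  forall e : R, 0 < e -> exists2 F, G F & m (E `+ F) <= e.

Lemma approximable_in E : G E -> approximable E.
Proof.
move=> GE; split; first exact: Gm.
by move=> e e0; exists E => //; rewrite setDv setU0 measure0 ltW.
Qed.

Lemma approximableU A B : approximable A -> approximable B ->
  approximable (A `|` B).
Proof.
move=> [mA hA] [mB hB]; split; first exact: measurableU.
move=> e e0; have e2 : 0 < e / 2 by rewrite divr_gt0.
have [F GF Fe] := hA _ e2; have [F' GF' Fe'] := hB _ e2.
exists (F `|` F'); first exact: GU.
have mF := Gm GF; have mF' := Gm GF'.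
apply: (@le_trans _ _ (m (A `+ F) + m (B `+ F'))); last lra.
apply: fine_measure_leU; try by apply: measurableU; apply: measurableD => //;
  apply: measurableU.
move=> x [[[Ax|Bx] /not_orP[nF nF']]|[[Fx|Fx] /not_orP[nA nB]]].
- by left; left.
- by right; left.
- by left; right.
- by right; right.
Qed.

(** Complements leave the symmetric difference unchanged. A countable union is replaced by a finite
    one at cost e / 2, by continuity from below, and the finite union is then approximated at cost e
    / 2. *)
Lemma sigma_algebra_approximable : sigma_algebra setT approximable.
Proof.
split; first exact: approximable_in.
  move=> A [mA hA]; rewrite setTD; split; first exact: measurableC.
  move=> e e0; have [F GF Fe] := hA e e0; exists (~` F); first exact: GC.
  rewrite (_ : ~` A `+ ~` F = A `+ F)// !setDE !setCK [RHS]setUC.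
  by rewrite [~` A `&` F]setIC [~` F `&` A]setIC.
move=> A hA; have mA i : measurable (A i) by have [] := hA i.
have mUA : measurable (\bigcup_k A k) by apply: bigcupT_measurable.
split => // e e0; have e2 : 0 < e / 2 by rewrite divr_gt0.
pose U n := \bigcup_(k < n) A k.
have hU n : approximable (U n).
  rewrite /U bigcup_mkord; elim: n => [|n IH].
    by rewrite big_ord0; apply: approximable_in.
  by rewrite big_ord_recr/=; apply: approximableU.
have mU n : measurable (U n) by have [] := hU n.
have [n Un] : exists n, m (\bigcup_k A k `\` U n) <= e / 2.
  have ndU : nondecreasing_seq U.
    move=> k l kl; apply/subsetPset => x [j /= jk Ax]; exists j => //=.
    exact: leq_trans kl.
  have UE : \bigcup_n U n = \bigcup_k A k.
    apply/seteqP; split => x [k _]; first by move=> [j _ Ax]; exists j.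
    by move=> Ax; exists k.+1 => //; exists k => /=.
  have := nondecreasing_cvg_mu (mu := mu) mU _ ndU; rewrite UE => /(_ mUA).
  rewrite -[X in _ --> X]fineK ?fin_num_measure// => /fine_cvg.
  set c := m _ => /cvgr_gt /(_ (c - e / 2)); rewrite ltrBlDr ltrDl => /(_ e2).
  case=> n _ /(_ n (leqnn _)) /= cn; exists n.
  have UA : U n `<=` \bigcup_k A k by rewrite -UE; exact: bigcup_sup.
  have : c = m (U n) + m (\bigcup_k A k `\` U n).
    have mD := measurableD mUA (mU n).
    rewrite -fineD; [|exact: fin_num_measure..].
    by rewrite -measureU// ?setDIK// setDUK.
  by move: cn; lra.
have [_ /(_ _ e2)[F GF Fe]] := hU n; exists F => //; have mF := Gm GF.
apply: (@le_trans _ _ (m (\bigcup_k A k `\` U n) + m (U n `+ F))); last lra.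
apply: fine_measure_leU; rewrite ?setDUl; try apply: measurableU;
  try exact: measurableD.
move=> x [[Ax nF]|[Fx nA]].
  by have [Ux|Ux] := pselect (U n x); [right; left|left].
by right; right; split => // -[k _ Akx]; apply: nA; exists k.
Qed.

End Approximation.

(** * Entropy of the lift of a monotone system *)

(* When the means diverge, [limn] is the junk value 0: hence the hypothesis on
   h. *)
Lemma limn_mean_le (R : realType) (v : nat -> R) (h : R) : 0 <= h ->
  (forall e, 0 < e -> exists C, forall n, v n <= n%:R * (h + e) + C) ->
  limn (fun n => n%:R^-1 * v n) <= h.
Proof.
move=> h0 hv; set u := fun n => _.
have [cu|ncu] := pselect (cvgn u); last by rewrite dvgP.
apply/ler_addgt0Pr => e e0; have e2 : 0 < e / 2 by rewrite divr_gt0.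
have [C vC] := hv _ e2; apply: limr_le => //.
exists (Num.trunc (C / (e / 2))).+1 => // n /= Cn.
have n0 : 0 < n%:R :> R by rewrite ltr0n (leq_ltn_trans _ Cn).
rewrite /u mulrC ler_pdivrMr// (le_trans (vC n))//.
have : C / (e / 2) < n%:R.
  by rewrite (lt_le_trans (truncnS_gt _))// ler_nat.
rewrite ltr_pdivrMr// => CnE; lra.
Qed.

(** The tangent bound ln (t x) <= t x - 1 with slope t = e / (S + 1). *)
Lemma ln_natS_le (R : realType) (S : nat) (e : R) : 0 < e ->
  exists C, forall n, ln (n * S).+1%:R <= n%:R * e + C.
Proof.
move=> e0; pose t := e / S.+1%:R; have t0 : 0 < t by rewrite divr_gt0 ?ltr0n.
exists (t - ln t - 1) => n.
have := @ln_leBx1 R (t * (n * S).+1%:R); rewrite mulr_gt0 ?ltr0n// => /(_ isT).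
rewrite lnM ?posrE ?ltr0n// => h.
have : t * (n * S)%:R <= n%:R * e.
  rewrite natrM mulrCA ler_wpM2l// /t mulrAC ler_pdivrMr ?ltr0n// ler_pM2l//.
  by rewrite ler_nat.
by move: h; rewrite -[(n * S).+1%:R]natr1 mulrDr; lra.
Qed.

Section SymbolicIFS.
Variables (R : realType) (I : pointedFinType) (phi : I -> R -> R).
Hypotheses (phi_homo : forall i x y, x <= y -> phi i x <= phi i y)
  (phi_meas : forall i, measurable_fun setT (phi i)).

Local Notation T := (symbolic_space I * R)%type.
Local Notation Phi := (ifs_lift phi).

Definition first_letter (p : T) : I := p.1 0%N.

Lemma measurable_letter k (Q : set I) :
  measurable [set w : symbolic_space I | Q (w k)].
Proof.
rewrite (_ : [set _ | _] = \bigcup_(i in Q)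
  [set w : symbolic_space I | w k = i]).
  apply: fin_bigcup_measurable => [|i _]; first exact: finite_finset.
  by apply: sub_sigma_algebra; exists k, i.
by apply/seteqP; split => [w Qw|w [i Qi /= ->]//]; exists (w k).
Qed.

Lemma measurable_fun_symbolic d (X : measurableType d) (f : X ->
  symbolic_space I) :
  (forall k i, measurable [set x | f x k = i]) -> measurable_fun setT f.
Proof.
move=> h.
have := @measurability _ _ X (symbolic_space I) setT f (@cylinders I);
  apply => //.
by move=> _ [_ [k [i ->]] <-]; rewrite setTI; exact: h.
Qed.

Lemma measurable_shift :
  measurable_fun setT (fun w : symbolic_space I => (fun k =>
    w k.+1) : symbolic_space I).
Proof.
by apply: measurable_fun_symbolic => k i;
  apply: (measurable_letter k.+1 [set i]).
Qed.

Lemma mlabel_letter k : mlabel (fun p : T => p.1 k).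
Proof.
move=> i; have := @measurable_fst _ _ (symbolic_space I) R measurableT _
  (measurable_letter k [set i]).
by rewrite setTI.
Qed.

Lemma mlabel_threshold t : mlabel (fun p : T => t <= p.2).
Proof.
have mt : measurable [set p : T | t <= p.2].
  have := @measurable_snd _ _ (symbolic_space I) R measurableT `[t,
    +oo[ (measurable_itv _).
  by rewrite setTI; congr measurable; apply/seteqP; split => p /=;
    rewrite in_itv/= andbT.
case; first by congr measurable: mt; apply/seteqP; split => p /=.
rewrite (_ : _ @^-1` _ = ~` [set p : T | t <= p.2]); first exact: measurableC.
by apply/seteqP; split => p /= => [->|/negP/negbTE].
Qed.

Lemma measurable_ifs_lift : measurable_fun setT Phi.
Proof.
apply/measurable_fun_pairP; split => /=.
  exact: measurableT_comp measurable_shift measurable_fst.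
(* The map applied depends on the first letter; a finite sum with one nonzero term reduces
   measurability to each single map. *)
have -> : snd \o Phi = fun p => \sum_(i : I)
  (if p.1 0%N == i then phi i p.2 else 0).
  apply/funext => p /=; rewrite (bigD1 (p.1 0%N))//= eqxx big1 ?addr0// => i.
  by rewrite eq_sym => /negPf ->.
apply: measurable_sum => i; apply: measurable_fun_ifT => //.
  apply: (measurable_fun_bool true); rewrite setTI.
  by have := mlabel_letter 0 i; congr measurable; apply/seteqP;
    split => p /= /eqP.
exact: measurableT_comp.
Qed.

Lemma iter_ifs_lift_fst n (p : T) k : (iter n Phi p).1 k = p.1 (n + k)%N.
Proof.
by elim: n k => [//|n IH] k; rewrite iterS /= IH addnS.
Qed.

Lemma itinerary_first_letter n (p : T) :
  itinerary Phi first_letter n p = [ffun i : 'I_n => p.1 i].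
Proof.
by apply/ffunP => i; rewrite !ffunE /first_letter iter_ifs_lift_fst addn0.
Qed.

(** The classes of this relation are the atoms of the algebra generated by the first m letters and
    the half-lines [[t, +oo[] with t in s. Simple labels and sets are those constant on such
    atoms. *)
Definition agree m (s : seq R) (p q : T) : Prop :=
  (forall k, (k < m)%N -> p.1 k = q.1 k) /\
  (forall t, t \in s -> (t <= p.2) = (t <= q.2)).

Definition simple_label m s (K : Type) (X : T -> K) :=
  forall p q, agree m s p q -> X p = X q.

Definition simple_set : set (set T) :=
  [set E | exists m s, simple_label m s E].

Lemma mlabel_simple m s (K : finType) (X : T -> K) :
  simple_label m s X -> mlabel X.
Proof.
move=> sX.
pose Y (p : T) := ([ffun i : 'I_m => p.1 i], [ffun i : 'I_(size s) =>
  s`_i <= p.2]).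
apply: (@mlabel_det _ _ _ _ X Y).
  apply: mlabel_pair; apply: mlabel_ffun => i; first exact: mlabel_letter.
  exact: mlabel_threshold.
move=> p q [/ffunP h1 /ffunP h2]; apply: sX;
  split => [k km|t /(nthP 0)[i si <-]].
  by have := h1 (Ordinal km); rewrite !ffunE.
by have := h2 (Ordinal si); rewrite !ffunE.
Qed.

Lemma agree_le m m' s s' p q : (m' <= m)%N -> {subset s' <= s} ->
  agree m s p q -> agree m' s' p q.
Proof.
by move=> mm ss [h1 h2]; split => [k km|t /ss];
  [apply/h1/(leq_trans km)|exact: h2].
Qed.

Lemma simple_set_measurable : simple_set `<=` measurable.
Proof.
move=> E [m [s sE]].
have mE : mlabel (fun p => `[< E p >]).
  by apply: (@mlabel_simple m s) => p q /sE ->.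
by have := mE true; congr (measurable _); apply/seteqP; split => p /= /asboolP.
Qed.

Lemma simple_setC : setC_closed simple_set.
Proof. by move=> E [m [s sE]]; exists m, s => p q /sE;
  rewrite /setC /= => ->. Qed.

Lemma simple_setU : setU_closed simple_set.
Proof.
move=> E F [m [s sE]] [m' [s' sF]]; exists (maxn m m'), (s ++ s') => p q pq.
rewrite /setU /=; congr (_ \/ _).
  by apply: sE; apply: agree_le pq; rewrite ?leq_maxl// => t ts;
    rewrite mem_cat ts.
by apply: sF; apply: agree_le pq; rewrite ?leq_maxr// => t ts;
  rewrite mem_cat ts orbT.
Qed.

Lemma simple_set0 : simple_set set0.
Proof. by exists 0%N, [::]. Qed.

(** The approximable sets form a sigma-algebra, so it suffices to have the generators of the two
    factors, cylinders and closed half-lines, which are simple. *)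
Lemma measurable_approximable (mu : probability T R) :
  measurable `<=` approximable mu simple_set.
Proof.
have sa : sigma_algebra setT (approximable mu simple_set).
  apply: sigma_algebra_approximable; [exact: simple_set_measurable|
    exact: simple_setC|exact: simple_setU|exact: simple_set0].
have ain := @approximable_in _ _ _ mu _ simple_set_measurable.
apply: smallest_sub => // E [|] [A mA <-]; rewrite setTI.
  suff : measurable `<=` image_set_system setT fst (approximable mu simple_set).
    by move=> /(_ _ mA); rewrite /image_set_system /= setTI.
  apply: smallest_sub => [|_ [k [i ->]]]; first exact: sigma_algebra_image.
  rewrite /image_set_system /= setTI; apply: ain.
  by exists k.+1, [::] => p q [/(_ k (ltnSn k)) h _] /=; rewrite h.
suff : measurable `<=` image_set_system setT snd (approximable mu simple_set).
  by move=> /(_ _ mA); rewrite /image_set_system /= setTI.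
have -> : @measurable _ R = <<s @RGenCInfty.G R >>.
  exact: RGenCInfty.measurableE.
apply: smallest_sub => [|_ [x ->]]; first exact: sigma_algebra_image.
rewrite /image_set_system /= setTI; apply: ain;
  exists 0%N, [:: x] => p q [_ h] /=.
by rewrite !in_itv/= !andbT h ?mem_head.
Qed.

(** For two ordered points, this turns equal numbers of thresholds below them into equal positions
    with respect to each threshold. *)
Lemma count_homo_eq (A : eqType) (a b : pred A) (s : seq A) :
  (forall t, a t -> b t) -> count a s = count b s -> {in s, a =1 b}.
Proof.
move=> ab; elim: s => [//|t s IH] /= e.
have le_s : (count a s <= count b s)%N by apply: sub_count.
have : a t = b t /\ count a s = count b s.
  case: (a t) (b t) e (ab t) => -[] /= e; rewrite ?add1n ?add0n in e *.
  - by case: e.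
  - by move=> /(_ isT).
  - by move: le_s; rewrite e ltnn.
  - by [].
by case=> abt /IH {}IH u; rewrite in_cons => /predU1P[->//|/IH].
Qed.

(** The first n + m letters give all windows of m letters starting before time n. The positions of
    the orbit are then fixed by one total count of thresholds, which has n * [size s] + 1 possible
    values and so costs only a logarithm. *)
Lemma itinerary_simple (mu : probability T R) (K : finType) (Z : T -> K) m s n :
  simple_label m s Z ->
  partition_entropy mu (itinerary Phi Z n) <=
  partition_entropy mu (itinerary Phi first_letter (n + m)) +
  ln (n * size s).+1%:R.
Proof.
move=> sZ; pose c (p : T) := count (fun t => t <= p.2) s.
pose g (p : T) := (\sum_(k < n) c (iter k Phi p))%N.
have gs p : (g p < (n * size s).+1)%N.
  rewrite ltnS /g -[n in (n * _)%N]card_ord -sum_nat_const leq_sum// => k _.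
  exact: count_size.
pose G (p : T) : 'I_(n * size s).+1 := inord (g p).
have ma : mlabel (itinerary Phi first_letter (n + m)).
  by apply: mlabel_itinerary; [exact: measurable_ifs_lift|exact:
    (mlabel_letter 0)].
have mG : mlabel G.
  pose W (p : T) := [ffun k : 'I_n => [ffun j : 'I_(size s) =>
    s`_j <= (iter k Phi p).2]].
  apply: (@mlabel_det _ _ _ _ _ W).
    apply: mlabel_ffun => k; apply: mlabel_ffun => j.
    exact: (mlabel_iter measurable_ifs_lift k (mlabel_threshold s`_j)).
  move=> p q /ffunP Wpq; rewrite /G /g; congr inord; apply: eq_bigr => k _.
  have := Wpq k; rewrite !ffunE => /ffunP Wk;
    apply: eq_in_count => t /(nthP 0)[i si <-].
  by have := Wk (Ordinal si); rewrite !ffunE.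
pose Y (p : T) := (itinerary Phi first_letter (n + m) p, G p).
apply: (@le_trans _ _ (partition_entropy mu Y)); last first.
  apply: le_trans (partition_entropy_pair _ _ _) _ => //.
  by rewrite lerD2l (le_trans (partition_entropy_le_card _ mG))// card_ord.
(* For points with the same letters the orbit is monotone in the starting point,
   so two such points with equal total counts G have equal counts at every
   time. *)
apply: partition_entropy_det; first exact: mlabel_pair.
suff h (p q : T) : Y p = Y q -> p.2 <= q.2 ->
  itinerary Phi Z n p = itinerary Phi Z n q.
  by move=> p q Ypq; have [|/ltW] := leP p.2 q.2; [exact: h|move/h => ->].
rewrite /Y !itinerary_first_letter => -[/ffunP pq Gpq] le_pq.
have pqE k : (k < n + m)%N -> p.1 k = q.1 k.
  by move=> knm; have := pq (Ordinal knm); rewrite !ffunE.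
have xk k : (k <= n)%N -> (iter k Phi p).2 <= (iter k Phi q).2.
  elim: k => [//|k IH] kn; rewrite !iterS /= !iter_ifs_lift_fst addn0.
  by rewrite pqE ?phi_homo ?IH// ?ltn_addr// ltnW.
have ck (k : 'I_n) : c (iter k Phi p) = c (iter k Phi q).
  have cle (j : 'I_n) : true -> (c (iter j Phi p) <= c (iter j Phi q) ?= iff
      (c (iter j Phi p) == c (iter j Phi q)))%N.
    by move=> _; apply/leqif_eq/sub_count => t /= /le_trans; apply;
      apply/xk/ltnW.
  have := leqif_sum cle; case=> _; rewrite -/(g p) -/(g q).
  have -> : g p = g q by have := congr1 val Gpq; rewrite /= !inordK.
  by rewrite eqxx => /esym /forallP /(_ k) /eqP.
apply/ffunP => k; rewrite !ffunE; apply: sZ; split.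
  by move=> j jm; rewrite !iter_ifs_lift_fst pqE// -addSn leq_add// ltnW.
apply: count_homo_eq (ck k) => t tp; apply: le_trans tp (xk _ _); exact: ltnW.
Qed.

(** Each cell of X is approximated by a simple set [F a] up to e / [#|K|], and Z picks some a with p
    in [F a]. Outside the union of the symmetric differences only a = X p qualifies; the default
    [a0] can matter only inside it. *)
Lemma simple_label_approximation (mu : probability T R) (K : finType) (X : T ->
  K) e :
  mlabel X -> 0 < e -> exists m s (Z : T -> K),
    simple_label m s Z /\ fine (mu [set p | X p <> Z p]) <= e.
Proof.
move=> mX e0.
have a0 : K by exact: X point.
have K0 : 0 < #|K|%:R :> R by rewrite ltr0n (cardD1 a0).
pose D A B : set T := (A `\` B) `|` (B `\` A).
have /choice[F hF] : forall a, exists F, simple_set F /\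
    fine (mu (D (X @^-1` [set a]) F)) <= e / #|K|%:R.
  move=> a; have [_ h] := measurable_approximable mu (mX a).
  by have [|F] := h (e / #|K|%:R); [rewrite divr_gt0|exists F].
have mF a : measurable (F a) by have [/simple_set_measurable] := hF a.
have mD a : measurable (D (X @^-1` [set a]) (F a)).
  by apply: measurableU; apply: measurableD.
have /choice[ms hms] : forall a, exists ms : nat * seq R,
  simple_label ms.1 ms.2 (F a).
  by move=> a; have [[m [s sF]] _] := hF a; exists (m, s).
pose Z (p : T) := odflt a0 [pick a | `[< F a p >]].
exists (\max_a (ms a).1), (flatten [seq (ms a).2 | a <- enum K]), Z.
have sZ : simple_label (\max_a (ms a).1) (flatten [seq
  (ms a).2 | a <- enum K]) Z.
  move=> p q pq; rewrite /Z; congr odflt; apply: eq_pick => a; congr asbool.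
  apply: hms; apply: agree_le pq; first exact: (leq_bigmax a).
  by move=> t ta; apply/flatten_mapP; exists a => //; rewrite mem_enum.
split => //.
have XZ : [set p | X p <> Z p] `<=` \big[setU/set0]_(a <- enum K) D (X @^-1`
  [set a]) (F a).
  move=> p /=; rewrite -bigcup_seq; apply: contra_notP => nD.
  have FX a : F a p <-> X p = a.
    have : ~ D (X @^-1` [set a]) (F a) p by move=> Da; apply: nD;
      exists a => //=; rewrite mem_enum.
    rewrite /D => /not_orP[/not_andP h1 /not_andP h2]; split.
      by move=> Fa; case: h2 => // /contrapT.
    by move=> Xa; case: h1 => // /contrapT.
  rewrite /Z; case: pickP => [a /asboolP /FX //|/(_ (X p)) /asboolP].
  by case; apply/FX.
have mB (r : seq K) : measurable (\big[setU/set0]_(a <- r) D (X @^-1` [set a])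
  (F a)).
  by apply: bigsetU_measurable.
have mXZ : measurable [set p | X p <> Z p].
  exact: (mlabel_preimage [set c | c.1 <> c.2] (mlabel_pair mX
    (mlabel_simple sZ))).
have := @fine_measure_leU _ _ _ mu _ _ _ mXZ (mB (enum K)) measurable0.
rewrite setU0 measure0 addr0 => /(_ XZ) /le_trans; apply.
have le_sum (r : seq K) : fine (mu (\big[setU/set0]_(a <- r) D (X @^-1`
  [set a]) (F a)))
    <= (size r)%:R * (e / #|K|%:R).
  elim: r => [|a r IH]; first by rewrite big_nil measure0 mul0r.
  rewrite big_cons -natr1 mulrDl mul1r addrC.
  apply: (@le_trans _ _ (fine (mu (D (X @^-1` [set a]) (F a))) +
     fine (mu (\big[setU/set0]_(a <- r) D (X @^-1` [set a]) (F a))))).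
    by apply: fine_measure_leU => //; exact: measurableU.
  by rewrite lerD//; have [] := hF a.
apply: (le_trans (le_sum _)); by rewrite -cardE mulrC divfK ?gt_eqF.
Qed.

(** An arbitrary partition is replaced by a simple one at cost e / 2 per step. The itinerary of the
    simple one is coded by n + m letters and a count whose logarithm is absorbed in the other e / 2,
    and the letters are grouped into blocks of length N. *)
Lemma measure_entropy_le_words (mu : probability T R) N :
  invariant_measure mu Phi -> (0 < N)%N ->
  (measure_entropy mu Phi <=
    (partition_entropy mu (itinerary Phi first_letter N) / N%:R)%:E)%E.
Proof.
move=> muinv N0; set HN := partition_entropy mu _.
have mPhi := measurable_ifs_lift; have ma := mlabel_letter 0.
have HN0 : 0 <= HN.
  by apply: partition_entropy_ge0; apply: mlabel_itinerary.
apply: ub_ereal_sup => _ [k [xi [mxi ->]]]; rewrite lee_fin.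
apply: limn_mean_le; first by rewrite divr_ge0.
move=> e e0; have e2 : 0 < e / 2 by rewrite divr_gt0.
have [dl dl0 hdl] := partition_entropy_error_small mu mxi e2.
have [m [s [Z [sZ XZ]]]] := simple_label_approximation mu mxi dl0.
have mZ := mlabel_simple sZ; have {}XZ := hdl _ mZ XZ.
have [C hC] := ln_natS_le (size s) e2.
exists ((m%:R / N%:R + 1) * HN + C) => n.
have h1 := partition_entropy_itinerary_error mPhi muinv n mxi mZ.
have h2 := itinerary_simple mu n sZ.
have h3 := partition_entropy_itinerary_block mPhi muinv (n + m) ma N0.
have h4 := hC n; rewrite -/HN natrD in h3.
have h5 : n%:R * partition_entropy mu (label_error xi Z) <= n%:R * (e / 2).
  by rewrite ler_wpM2l.
apply: (le_trans h1); apply: le_trans (lerD (le_trans h2 (lerD h3 h4)) h5) _.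
by rewrite le_eqVlt; apply/orP; left; apply/eqP; field; rewrite pnatr_eq0 -lt0n.
Qed.

(** In other words, the symbolic marginal of mu is the Bernoulli measure with equal weights. *)
Definition uniform_words (mu : probability T R) := forall n (w : {ffun 'I_n ->
  I}),
  fine (mu [set p : T | forall i : 'I_n, p.1 i = w i]) = (#|I| ^ n)%:R^-1.

Lemma label_pr_words (mu : probability T R) n (w : {ffun 'I_n -> I}) :
  label_pr mu (itinerary Phi first_letter n) w =
  fine (mu [set p : T | forall i : 'I_n, p.1 i = w i]).
Proof.
congr (fine (mu _)); apply/seteqP; split => p /=;
  rewrite itinerary_first_letter.
  by move=> <- i; rewrite ffunE.
by move=> h; apply/ffunP => i; rewrite ffunE.
Qed.

(** The word bound with N = n shows that the first n letters have entropy at least n ln [#|I|], the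
    largest possible value, and the equality case forces the uniform distribution. The empty word is
    separate because the bound divides by N. *)
Lemma entropy_uniform_words (mu : probability T R) : invariant_measure mu Phi ->
  ((ln #|I|%:R)%:E <= measure_entropy mu Phi)%E -> uniform_words mu.
Proof.
move=> muinv hmu n w; rewrite -label_pr_words.
have ma : mlabel (itinerary Phi first_letter n).
  by apply: mlabel_itinerary; [exact: measurable_ifs_lift|exact:
    (mlabel_letter 0)].
have I0 : (0 < #|I|)%N by rewrite (cardD1 point).
have -> : (#|I| ^ n = #|{ffun 'I_n -> I}|)%N by rewrite card_ffun card_ord.
apply: partition_entropy_uniform => //; rewrite card_ffun card_ord.
case: n w ma => [|n] w ma; first by rewrite expn0 ln1 partition_entropy_ge0.
have := le_trans hmu (measure_entropy_le_words muinv (ltn0Sn n)).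
by rewrite lee_fin ler_pdivlMr ?ltr0n// mulr_natr natrX lnXn ?ltr0n.
Qed.

Lemma measure_entropy_le_card (mu : probability T R) : invariant_measure mu Phi
  ->
  (measure_entropy mu Phi <= (ln #|I|%:R)%:E)%E.
Proof.
move=> muinv; apply: (le_trans (measure_entropy_le_words muinv (ltn0Sn 0))).
have ma : mlabel (itinerary Phi first_letter 1).
  by apply: mlabel_itinerary; [exact: measurable_ifs_lift|exact:
    (mlabel_letter 0)].
have := partition_entropy_le_card mu ma.
by rewrite lee_fin divr1 card_ffun card_ord expn1.
Qed.

Lemma uniform_words_entropy (mu : probability T R) : invariant_measure mu Phi ->
  uniform_words mu -> ((ln #|I|%:R)%:E <= measure_entropy mu Phi)%E.
Proof.
move=> muinv umu; apply: ereal_sup_ubound => /=.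
have I0 : (0 < #|I|)%N by rewrite (cardD1 point).
(* The partition by the first letter attains the value; [enum_rank] only renames letters as
   ordinals. *)
exists #|I|, (fun p => enum_rank (first_letter p)); split.
  by apply: (mlabel_det (mlabel_letter 0)) => p q; rewrite /first_letter => ->.
congr (_%:E); apply/esym/cvg_lim => //.
set xi := fun p => enum_rank (first_letter p).
have ma n : mlabel (itinerary Phi first_letter n).
  by apply: mlabel_itinerary; [exact: measurable_ifs_lift|exact:
    (mlabel_letter 0)].
have mxi n : mlabel (itinerary Phi xi n).
  apply: (mlabel_det (ma n)) => p q /ffunP h; apply/ffunP => i.
  by have := h i; rewrite !ffunE /xi => ->.
have HE n : partition_entropy mu (itinerary Phi xi n) = n%:R * ln #|I|%:R.
  transitivity (partition_entropy mu (itinerary Phi first_letter n)).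
    apply/eqP; rewrite eq_le; apply/andP; split;
      apply: partition_entropy_det => //.
      by move=> p q /ffunP h; apply/ffunP => i; have := h i;
        rewrite !ffunE /xi => ->.
    move=> p q /ffunP h; apply/ffunP => i; have := h i; rewrite !ffunE /xi.
    exact: enum_rank_inj.
  rewrite partition_entropyE.
  under eq_bigr do rewrite label_pr_words umu.
  rewrite sumr_const card_ffun card_ord -[X in - X]mulr_natl mulrA mulfV ?mul1r.
    by rewrite lnV ?posrE ?ltr0n ?expn_gt0 ?I0// opprK natrX lnXn ?ltr0n//
      mulr_natl.
  by rewrite pnatr_eq0 -lt0n expn_gt0 I0.
(* The means are constant from n = 1 on; at n = 0 the inverse is 0. *)
apply: cvg_near_cst; exists 1%N => // n /= n0.
by rewrite HE mulKf// pnatr_eq0 -lt0n.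
Qed.

End SymbolicIFS.

(** * A measure of maximal entropy *)

Lemma probability_image d d' (X : measurableType d) (Y : measurableType d')
    (R : realType) (P : probability X R) (f : X -> Y) :
  measurable_fun setT f ->
  exists Q : probability Y R, forall A, Q A = P (f @^-1` A).
Proof.
move=> mf; pose F : {mfun X >-> Y} := HB.pack f
  (isMeasurableFun.Build _ _ _ _ f mf).
by exists (distribution P F).
Qed.

Section FairCoin.
Variable R : realType.
Local Notation leb := (@lebesgue_measure R).

(** Twice the image of Lebesgue measure under u -> 2 u - c agrees with length on half-open
    intervals, hence is Lebesgue measure by uniqueness. *)
Lemma lebesgue_measure_double (c : R) (A : set
  (measurableTypeR R)) : measurable A ->
  leb ((fun u => 2 * u - c) @^-1` A) = (2^-1%:E * leb A)%E.
Proof.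
move=> mA; pose g (u : measurableTypeR R) : measurableTypeR R := 2 * u - c.
have mg : measurable_fun setT g.
  by apply: measurable_funB => //; apply: measurable_funM.
pose two : {nonneg R} := NngNum (ler0n R 2).
have : mscale two (pushforward leb g) A = leb A.
  symmetry; unshelve refine (@lebesgue_measure_unique R (mscale two
    (pushforward leb g)) _ A mA) => _ [[a b] _ <-].
  transitivity (2%:E * leb (g @^-1` `]a, b]))%E => //.
  have -> : g @^-1` `]a, b] = `](a + c) / 2, (b + c) / 2].
    by apply/seteqP; split => u; rewrite /=
      /g !in_itv/= ltr_pdivrMr// ler_pdivlMr// => /andP[? ?];
    apply/andP; split; lra.
  rewrite !lebesgue_measure_itv/= !lte_fin ltr_pM2r ?invr_gt0// ltrD2r.
  case: ifP => _; last by rewrite mule0.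
  by rewrite -!EFinB -EFinM; congr (_%:E); lra.
move=> <-; rewrite [X in (_ = _ * X)%E](_ : _ = 2%:E * leb (g @^-1` A))%E//.
by rewrite muleA -EFinM mulVf// mul1e.
Qed.

Let mI : measurable (`[0, 1[ : set (measurableTypeR R)).
Proof. exact: measurable_itv. Qed.

Definition unit_lebesgue := mrestr leb mI.

HB.instance Definition _ := Measure.on unit_lebesgue.

Let unit_lebesgueT : unit_lebesgue setT = 1%E.
Proof.
by rewrite /unit_lebesgue /mrestr setTI lebesgue_measure_itv/= lte_fin ltr01
  sube0.
Qed.

HB.instance Definition _ := Measure_isProbability.Build _ _ _ unit_lebesgue
  unit_lebesgueT.

(** On [0, 1[ this is multiplication by 2 modulo 1, whose itinerary with respect to the two halves
    is the binary expansion. The term [- 0] gives both branches the form 2 u - c. *)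
Let doubling (u : measurableTypeR R) : measurableTypeR R :=
  if 2^-1 <= u then 2 * u - 1 else 2 * u - 0.

Let mhalf : measurable_fun setT (fun u : measurableTypeR R => 2^-1 <= u).
Proof.
apply: (measurable_fun_bool true); rewrite setTI.
have : measurable (`[2^-1, +oo[ : set (measurableTypeR R))
  by exact: measurable_itv.
by congr measurable; apply/seteqP; split => u; rewrite /= in_itv/= andbT.
Qed.

Let mdoubling : measurable_fun setT doubling.
Proof.
by apply: measurable_fun_ifT => //; apply: measurable_funB => //;
   apply: measurable_funM.
Qed.

Let digits (u : measurableTypeR R) : symbolic_space bool :=
  fun k => 2^-1 <= iter k doubling u.

Let mdigits : measurable_fun setT digits.
Proof.
apply: measurable_fun_symbolic => k i.
have miter : measurable_fun setT (iter k doubling).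
  elim: k => [|k IH]; first exact: measurable_id.
  exact: (measurableT_comp mdoubling IH).
have mi : measurable [set i] by [].
by have := measurableT_comp mhalf miter; move=> /(_ measurableT _ mi);
  rewrite setTI.
Qed.

Let digits_shift u : (fun k => digits u k.+1) = digits (doubling u).
Proof. by apply/funext => k; rewrite /digits iterSr. Qed.

(** B is the law of the binary digits of a uniform point of [0, 1[. Fixing the first digit i
    restricts to one half of the interval, which u -> 2 u - i maps onto [0, 1[ with lengths
    doubled. *)
Lemma fair_coin_exists : exists B : probability (symbolic_space bool) R,
  forall (i : bool) (A : set (symbolic_space bool)), measurable A ->
    B [set w : symbolic_space bool | w 0%N = i /\ A (fun k =>
      w k.+1)] = (2^-1%:E * B A)%E.
Proof.
have [B BE] := probability_image unit_lebesgue mdigits; exists B => i A mA.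
have {}BE C : B C = leb (digits @^-1` C `&` `[0, 1[) by rewrite BE.
rewrite !BE -(lebesgue_measure_double (i%:R)); last first.
  by apply: measurableI => //; have := mdigits measurableT mA; rewrite setTI.
congr (leb _); apply/seteqP; split => u /=; rewrite !in_itv/= digits_shift.
  move=> [[<- dA] /andP[u0 u1]]; rewrite (_ : digits u 0%N = (2^-1 <= u))//.
  move: dA; rewrite /doubling; case: (leP 2^-1 u) => h dA /=.
    by split; [exact: dA|apply/andP; split; lra].
  by split; [exact: dA|apply/andP; split; lra].
move=> [dA /andP[u0 u1]]; move: dA; rewrite /doubling /digits.
case: i u0 u1 => /= u0 u1; [have h : 2^-1 <= u by lra|have h : ~~ (2^-1 <= u)
  by lra].
  by rewrite h => dA; split => //; apply/andP; split; lra.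
rewrite (negbTE h) => dA; split => //; apply/andP; split; lra.
Qed.

End FairCoin.

(** * The Bernoulli convolution and the invariant product measure *)

Section BernoulliMeasure.
Variables (R : realType) (lam : R).
Hypotheses (lam_half : 2^-1 < lam) (lam1 : lam < 1).
Let L := (1 - lam)^-1.
Local Notation phi := (bernoulli_ifs lam).
Local Notation T := (symbolic_space bool * R)%type.
Local Notation Phi := (ifs_lift phi).

Let lam0 : 0 < lam. Proof. exact: lt_trans lam_half. Qed.

Lemma bernoulli_ifs_homo i x y : x <= y -> phi i x <= phi i y.
Proof. by move=> xy; rewrite /bernoulli_ifs lerD2r ler_pM2l. Qed.

Lemma bernoulli_ifs_measurable i : measurable_fun setT (phi i).
Proof. by apply: measurable_funD => //; apply: measurable_funM. Qed.

Let term (w : symbolic_space bool) k : R := lam ^+ k * (if w k then 1 else -1).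

(** The canonical projection pi(omega), the sum of the lambda^k with signs given by the letters; its
    law under the fair coin is the Bernoulli convolution. *)
Definition bernoulli_projection (w : symbolic_space bool) : R :=
  limn (series (term w)).

Let norm_term w k : `|term w k| = lam ^+ k.
Proof.
rewrite normrM gtr0_norm ?exprn_gt0//.
by case: (w k); rewrite ?normrN normr1 mulr1.
Qed.

Let cvg_term w : cvgn (series (term w)).
Proof.
apply: normed_cvg; apply: (@series_le_cvg _ _ (geometric 1 lam)) => [n|n|n|].
- exact: normr_ge0.
- by rewrite /= mul1r exprn_ge0// ltW.
- by rewrite /= mul1r norm_term.
by apply: is_cvg_geometric_series; rewrite gtr0_norm.
Qed.

Let series_shift w n : series (term w) n.+1 =
  phi (w 0%N) (series (term (fun k => w k.+1)) n).
Proof.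
rewrite /series /= big_nat_recl// addrC /bernoulli_ifs; congr (_ + _).
  by rewrite mulr_sumr; apply: eq_bigr => k _; rewrite /term exprS mulrA.
by rewrite /term expr0 mul1r.
Qed.

Lemma bernoulli_projection_le w : `|bernoulli_projection w| <= L.
Proof.
have sL n : `|series (term w) n| <= L.
  elim: n w => [|n IH] w; last by rewrite series_shift bernoulli_ifs_itv.
  by rewrite /series /= big_geq// normr0 invr_ge0 subr_ge0 ltW.
rewrite ler_norml; apply/andP; split.
  by apply: limr_ge => //; apply: nearW => n; have := sL n;
    rewrite ler_norml => /andP[].
by apply: limr_le => //; apply: nearW => n; have := sL n;
  rewrite ler_norml => /andP[].
Qed.

Lemma bernoulli_projection_shift w :
  bernoulli_projection w = phi (w 0%N) (bernoulli_projection (fun k => w k.+1)).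
Proof.
apply/cvg_lim => //; rewrite -(cvg_shiftS _).
under eq_fun do rewrite series_shift.
by apply: cvgD; [apply: cvgMr; exact: cvg_term|exact: cvg_cst].
Qed.

Lemma measurable_bernoulli_projection : measurable_fun setT
  bernoulli_projection.
Proof.
apply: (measurable_fun_cvg (h := fun n w => series (term w) n)) => [n|w _];
  last first.
  exact: cvg_term.
apply: measurable_sum => k; apply: measurable_funM => //.
apply: measurable_fun_ifT => //.
apply: (measurable_fun_bool true); rewrite setTI.
exact: (measurable_letter k [set true]).
Qed.

(** The measure is the product of the fair coin B and the Bernoulli convolution nu. The preimage of
    a rectangle D x C splits by the first letter i into pieces of mass B(D) nu(phi_i^-1 C) / 2, and
    self-similarity of nu adds them up to B(D) nu(C); uniqueness of product measures gives
    invariance. *)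
Lemma bernoulli_product_measure_exists : exists mu : probability T R,
  [/\ mu (lift_domain phi) = 1%E, invariant_measure mu Phi & uniform_words mu].
Proof.
have [B Bshift] := fair_coin_exists R.
have [nu nuE] := probability_image B measurable_bernoulli_projection.
pose mu : probability T R := (B \x nu)%E.
have muX A C : measurable A -> measurable C -> mu (A `*` C) = (B A * nu C)%E.
  by move=> mA mC; exact: product_measure1E.
have mphi i C : measurable C -> measurable (phi i @^-1` C).
  by move=> mC; have := bernoulli_ifs_measurable i measurableT mC;
    rewrite setTI.
have mPhi : measurable_fun setT Phi by exact: measurable_ifs_lift
  bernoulli_ifs_measurable.
have mshift (A : set (symbolic_space bool)) (i : bool) : measurable A ->
    measurable [set w : symbolic_space bool | w 0%N = i /\ A (fun k => w k.+1)].
  move=> mA; apply: measurableI; first exact: (measurable_letter 0 [set i]).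
  by have := measurable_shift measurableT mA; rewrite setTI.
have nu_phi C : measurable C ->
    nu C = (2^-1%:E * nu (phi true @^-1` C) + 2^-1%:E * nu
      (phi false @^-1` C))%E.
  move=> mC; rewrite !nuE.
  have mp D : measurable D -> measurable (bernoulli_projection @^-1` D).
    by move=> mD; have := measurable_bernoulli_projection measurableT mD;
      rewrite setTI.
  rewrite -(Bshift true _ (mp _ (mphi true _ mC))) -(Bshift false _ (mp _
    (mphi false _ mC))).
  have mBi i := mshift _ i (mp _ (mphi i _ mC)).
  rewrite -(measureU _ (mBi true) (mBi false)); last first.
    by apply/seteqP; split => w //= [[-> _] []].
  congr (B _); apply/seteqP; split => w /=;
    rewrite (bernoulli_projection_shift w).
    by case: (w 0%N) => h; [left|right].
  by case=> -[->].
exists mu; split.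
- have -> : lift_domain phi = setT `*` `[- L, L].
    rewrite /lift_domain limit_set_bernoulli//; congr (_ `*` _).
    by apply/seteqP; split => x; rewrite /= in_itv /= ler_norml.
  rewrite muX// [B _]probability_setT mul1e nuE -(@probability_setT _ _ _ B).
  congr (B _); apply/seteqP; split => w //= _.
  by have := bernoulli_projection_le w; rewrite ler_norml in_itv.
- move=> A mA.
  have <- : pushforward mu Phi A = mu (Phi @^-1` A) by [].
  symmetry; apply: (@product_measure_unique _ _ _ _ R B nu
    (pushforward mu Phi)) => // D C mD mC.
  pose U i := [set w : symbolic_space bool | w 0%N = i /\ D (fun k =>
    w k.+1)] `*`
    (phi i @^-1` C).
  have mU i : measurable (U i) by apply: measurableX;
    [exact: mshift|exact: mphi].
  transitivity (mu (U true `|` U false)).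
    congr (mu _); apply/seteqP; split => -[w x] /=.
      by rewrite /U /=; case: (w 0%N) => -[Dw Cx]; [left|right].
    by case=> -[[/= w0 Dw] Cx]; rewrite w0.
  transitivity (mu (U true) + mu (U false))%E.
    apply: measureU => //.
    by apply/seteqP; split => p //= -[[[/= w0 _] _] [[/=]]]; rewrite w0.
  rewrite !muX; [|(exact: mphi || exact: mshift)..].
  rewrite !Bshift//.
  transitivity (B D * (2^-1%:E * nu (phi true @^-1` C) + 2^-1%:E * nu
    (phi false @^-1` C)))%E.
    have h (b x y : \bar R) : b \is a fin_num -> x \is a fin_num ->
      y \is a fin_num ->
        (2^-1%:E * b * x + 2^-1%:E * b * y = b * (2^-1%:E * x + 2^-1%:E * y))%E.
      case: b x y => [b||] [x||] [y||]// _ _ _; rewrite -!EFinM -!EFinD;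
        congr EFin; ring.
    by apply: h; apply: fin_num_measure => //; exact: mphi.
  by congr (_ * _)%E; symmetry; exact: nu_phi.
move=> n w.
have -> : [set p : T | forall i : 'I_n, p.1 i = w i] =
    [set v : symbolic_space bool | forall i : 'I_n, v i = w i] `*` setT.
  by apply/seteqP; split => [p /=|p []].
have mcyl k (v : nat -> bool) :
    measurable [set u : symbolic_space bool | forall i : 'I_k, u i = v i].
  rewrite (_ : [set _ | _] = \bigcap_(i in [set: 'I_k])
    [set u : symbolic_space bool | u i = v i]).
    apply: fin_bigcap_measurable => [|i _]; first exact: finite_finset.
    exact: (measurable_letter i [set v i]).
  by apply/seteqP; split => u h i //=; exact: h.
have Bcyl k (v : nat -> bool) :
    B [set u : symbolic_space bool | forall i : 'I_k,
      u i = v i] = ((2 ^ k)%:R^-1)%:E.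
  elim: k v => [|k IH] v.
    by rewrite expn0 invr1 -(@probability_setT _ _ _ B); congr (B _);
      apply/seteqP; split => // u _ [].
  transitivity (B [set u : symbolic_space bool | u 0%N = v 0%N /\
      [set u : symbolic_space bool | forall i : 'I_k, u i = v i.+1] (fun j =>
        u j.+1)]).
    congr (B _); apply/seteqP; split => u /=.
      by move=> h; split; [exact: (h ord0)|move=> i; exact: (h (lift ord0 i))].
    move=> [h0 h] i; case: (unliftP ord0 i) => [j ->|-> //].
    exact: h.
  rewrite Bshift; last exact: (mcyl k (fun j => v j.+1)).
  by rewrite (IH (fun j => v j.+1)) -EFinM expnS natrM invfM.
(* The finite word is extended to all times by a dummy letter, since the induction on its length
   shifts it. *)
pose w' k := if insub k is Some i then w i else false.
have ww' (i : 'I_n) : w i = w' i by rewrite /w' valK.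
have -> : [set v : symbolic_space bool | forall i : 'I_n, v i = w i] =
    [set u : symbolic_space bool | forall i : 'I_n, u i = w' i].
  by apply/seteqP; split => u h i; rewrite h ww'.
by rewrite muX// Bcyl [nu _]probability_setT mule1 card_bool.
Qed.

End BernoulliMeasure.

(** * The overlap number *)

Lemma cvg_mean_linear (R : realType) (v : nat -> R) (l c : R) :
  (forall n, n%:R * l - ln n.+1%:R - c <= v n <= n%:R * l + c) ->
  (fun n => n%:R^-1 * v n) @ \oo --> l.
Proof.
move=> hv; apply/cvgrPdist_le => e e0; have e2 : 0 < e / 2 by rewrite divr_gt0.
have [C hC] := ln_natS_le 1 e2.
pose M := `|C| + `|c|; exists (Num.trunc (M / (e / 2))).+1 => // n /= Mn.
have n0 : 0 < n%:R :> R by rewrite ltr0n (leq_ltn_trans _ Mn).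
have : M / (e / 2) < n%:R by rewrite (lt_le_trans (truncnS_gt _))// ler_nat.
rewrite ltr_pdivrMr// => Mne.
have -> : l - n%:R^-1 * v n = (n%:R * l - v n) / n%:R.
  by rewrite mulrBl mulrAC mulfV ?gt_eqF// mul1r mulrC.
rewrite normrM normfV (gtr0_norm n0) ler_pdivrMr// ler_norml.
have := hC n; rewrite muln1 => lnn; have /andP[v1 v2] := hv n.
have C1 := ler_norm C; have c1 := ler_norm c; have C0 := normr_ge0 C.
have c0 := normr_ge0 c; have ne0 : 0 < n%:R * (e / 2) by rewrite mulr_gt0.
rewrite /M in Mne; apply/andP; split; lra.
Qed.

Section Overlap.
Variables (R : realType) (lam : R).
Hypotheses (lam_half : 2^-1 < lam) (lam1 : lam < 1)
  (garsia : garsia_number lam^-1).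
Let L := (1 - lam)^-1.
Local Notation phi := (bernoulli_ifs lam).
Local Notation T := (symbolic_space bool * R)%type.
Local Notation Phi := (ifs_lift phi).
Local Notation S := (fun w : seq bool => ifs_iter phi w 0).

Let lam0 : 0 < lam. Proof. exact: lt_trans lam_half. Qed.

Let lam2 : 1 < 2 * lam. Proof. by move: lam_half; lra. Qed.

Let mPhi : measurable_fun setT Phi.
Proof. by apply: measurable_ifs_lift => i; exact: bernoulli_ifs_measurable. Qed.

Lemma lift_domainE : lift_domain phi = [set p : T | `|p.2| <= L].
Proof.
by rewrite /lift_domain limit_set_bernoulli//; apply/seteqP; split => [p []|p].
Qed.

Lemma ifs_iter_mkseq n (p : T) : ifs_iter phi (mkseq p.1 n) p.2 =
  (iter n Phi p).2.
Proof.
elim: n => [//|n IH]; rewrite /mkseq -addn1 iotaD map_cat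
  /= cats1 ifs_iter_rcons.
by rewrite addn1 iterS /= -IH add0n iter_ifs_lift_fst addn0.
Qed.

(** phi_eta is affine with slope lambda^n and maps 0 to [S eta], so being in the image of the
    interval is a condition on the distance to [S eta]. The count thus depends on p only through the
    second coordinate of its n-th iterate. *)
Lemma overlap_countE n p :
  overlap_count phi n p = word_count lam n (iter n Phi p).2.
Proof.
rewrite /overlap_count /word_count; apply: eq_card => w;
  rewrite inE finset.in_set.
rewrite limit_set_bernoulli// ifs_iter_mkseq; set z := _.2.
have ln0 : 0 < lam ^+ n by rewrite exprn_gt0.
apply/asboolP/idP => [[y [yL ->]]|zw].
  rewrite ifs_iter_affine addrK size_tuple normrM gtr0_norm//.
  by rewrite ler_pM2l.
exists ((z - S w) / lam ^+ n); split.
  by rewrite /= normrM normfV (gtr0_norm ln0) ler_pdivrMr// mulrC.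
by rewrite [RHS]ifs_iter_affine size_tuple mulrC divfK ?gt_eqF// subrK.
Qed.

Let word n (p : T) : n.-tuple bool := [tuple of mkseq p.1 n].

Lemma iter_sub_word n p : `|p.2| <= L ->
  `|(iter n Phi p).2 - S (word n p)| <= lam ^+ n * L.
Proof.
move=> pL; rewrite -ifs_iter_mkseq ifs_iter_affine addrK size_mkseq.
by rewrite normrM gtr0_norm ?exprn_gt0// ler_pM2l ?exprn_gt0.
Qed.

Variable mu : probability T R.
Hypotheses (muD : mu (lift_domain phi) = 1%E) (mu_words : uniform_words mu).

Let f n (p : T) : R := ln (overlap_count phi n p)%:R.

Let mlabel_word n : mlabel (word n).
Proof.
have mw : mlabel (fun p : T => [ffun i : 'I_n => p.1 i]).
  by apply: mlabel_ffun => i; exact: (mlabel_letter i).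
apply: (mlabel_det mw) => p q /ffunP pq; apply: eq_from_tnth => i.
by have := pq i; rewrite !ffunE !(tnth_nth false) /= !nth_mkseq.
Qed.

Lemma uniform_words_tuple n (A : {set n.-tuple bool}) :
  fine (mu [set p | word n p \in A]) = #|A|%:R * 2^-1 ^+ n.
Proof.
transitivity (\sum_(w in A) label_pr mu (word n) w).
  exact: (label_pr_preimage mu (fun w => w \in A) (mlabel_word (n:=n))).
rewrite (eq_bigr (fun=> 2^-1 ^+ n)) => [|w _].
  by rewrite sumr_const mulr_natl.
have := mu_words [ffun i : 'I_n => tnth w i];
  rewrite card_bool natrX exprVn => <-.
congr (fine (mu _)); apply/seteqP; split => p /=.
  by move=> <- i; rewrite ffunE (tnth_nth false) /= nth_mkseq.
move=> h; apply: eq_from_tnth => i; rewrite (tnth_nth false) /= nth_mkseq//.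
by rewrite h ffunE.
Qed.

Let measurable_f n : measurable_fun setT (f n).
Proof.
pose z (p : T) := (iter n Phi p).2.
have mz : measurable_fun setT z.
  apply: measurableT_comp => //; elim: (n) => [|k IH];
    first exact: measurable_id.
  exact: (measurableT_comp mPhi IH).
(* The integrand is a function of this finite label, whose cells are cut out by closed conditions on
   [z], so its measurability is that of the label. *)
pose Y p := [ffun w : n.-tuple bool => `|z p - S w| <= lam ^+ n * L].
have mY : mlabel Y.
  apply: mlabel_ffun => w; set r := lam ^+ n * L.
  have mB : measurable [set p | `|z p - S w| <= r].
    have := mz measurableT `[S w - r, S w + r] (measurable_itv _);
      rewrite setTI.
    by congr measurable; apply/seteqP; split => p;
      rewrite /= in_itv/= -ler_distl.
  case; first by congr measurable: mB; apply/seteqP; split => p.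
  rewrite (_ : _ @^-1` _ = ~` [set p | `|z p - S w| <= r]);
    first exact: measurableC.
  by apply/seteqP; split => p /= => [->|/negP/negbTE].
move=> _ B mB; rewrite setTI.
have mfB : mlabel (fun p => `[< B (f n p) >]).
  apply: (mlabel_det mY) => p q /ffunP pq;
    rewrite /f !overlap_countE /word_count.
  congr asbool; congr (B (ln _%:R)); apply: eq_card => w;
    rewrite !finset.in_set.
  by have := pq w; rewrite !ffunE.
by have := mfB true; congr measurable; apply/seteqP; split => p /= /asboolP.
Qed.

Let mD : measurable (lift_domain phi).
Proof.
rewrite lift_domainE.
have := @measurable_snd _ _ (symbolic_space bool) R measurableT `[- L,
  L] (measurable_itv _).
by rewrite setTI; congr measurable; apply/seteqP; split => p;
  rewrite /= in_itv/= ler_norml.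
Qed.

Let f_ge0 n p : 0 <= f n p.
Proof.
rewrite /f; case: (overlap_count phi n p) => [|k]; first by rewrite ln0.
by rewrite ln_ge0// ler1n.
Qed.

Let I n := \int[mu]_(p in lift_domain phi) f n p.

Let mf_D n : measurable_fun (lift_domain phi) (fun p => (f n p)%:E).
Proof. by apply/measurable_EFinP; exact: measurable_funS (measurable_f n). Qed.

Let integral_le U n : 0 <= U -> (forall p, f n p <= U) ->
  (\int[mu]_(p in lift_domain phi) (f n p)%:E <= U%:E)%E.
Proof.
move=> U0 fU; rewrite -[leRHS]mule1 -muD -(integral_cst mu mD).
by apply: ge0_le_integral => //= p _; rewrite lee_fin.
Qed.

Let integral_fin n : (\int[mu]_(p in lift_domain phi) (f n p)%:E = (I n)%:E)%E.
Proof.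
rewrite /I /Rintegral fineK// ge0_fin_numE; last first.
  by apply: integral_ge0 => p _; rewrite lee_fin.
apply: (@le_lt_trans _ _ (ln (#|{: n.-tuple bool}|.+1%:R))%:E);
  last exact: ltry.
apply: integral_le; first by rewrite ln_ge0// ler1n.
move=> p; rewrite /f; case e : (overlap_count phi n p) => [|k].
  by rewrite ln0// ln_ge0// ler1n.
by rewrite ler_ln ?posrE ?ltr0n// ler_nat -e leqW// max_card.
Qed.

Lemma overlap_integral_le : exists c, forall n, I n <= n%:R * ln (2 * lam) + c.
Proof.
have [C C0 hC] := word_count_le lam0 lam1 garsia (ltW lam2).
(* The maximum with 0 keeps the bound nonnegative, as required where the count is 0 and the
   logarithm takes its default value 0. *)
pose c := Num.max 0 (ln C); exists c => n.
have c0 : 0 <= n%:R * ln (2 * lam) + c.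
  by rewrite addr_ge0// ?le_max ?lexx// mulr_ge0// ln_ge0// ltW.
have fc p : f n p <= n%:R * ln (2 * lam) + c.
  rewrite /f overlap_countE; have := hC n (iter n Phi p).2.
  case: (word_count _ _ _) => [|k] h; first by rewrite ln0.
  apply: (@le_trans _ _ (ln (C * (2 * lam) ^+ n))).
    by rewrite ler_ln ?posrE ?ltr0n// mulr_gt0// exprn_gt0// mulr_gt0.
  rewrite lnM ?posrE ?exprn_gt0 ?mulr_gt0// lnXn ?mulr_gt0// addrC
    [n%:R * _]mulr_natl.
  by rewrite lerD2l /c le_max lexx orbT.
by rewrite -lee_fin -integral_fin integral_le.
Qed.

(** Off the sparse words the integrand is at least ln K. The divisor n + 1 in K costs only ln (n +
    1), and it makes the sparse words so rare that discarding them costs a bounded amount although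
    ln K may grow linearly. *)
Lemma overlap_integral_ge n :
  n%:R * ln (2 * lam) - ln n.+1%:R - 6 * ln (2 * lam) <= I n.
Proof.
have l0 : 0 < ln (2 * lam) by rewrite ln_gt0.
have pow0 : 0 < (2 * lam) ^+ n by rewrite exprn_gt0// mulr_gt0.
pose K := (2 * lam) ^+ n / n.+1%:R; have K0 : 0 < K by rewrite divr_gt0// ltr0n.
have lnK : ln K = n%:R * ln (2 * lam) - ln n.+1%:R.
  by rewrite ln_div ?posrE ?ltr0n// lnXn ?mulr_gt0// [in RHS]mulr_natl.
(* When ln K < 0 the bound is negative and the integral is not; otherwise ln K may be multiplied
   into mass inequalities. *)
rewrite -lnK; have [k0|k0] := ltP (ln K) 0.
  apply: (@le_trans _ _ 0); first by lra.
  by rewrite -lee_fin -integral_fin; apply: integral_ge0 => p _;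
    rewrite lee_fin.
pose A := sparse_words lam n K; pose G := [set p | word n p \notin A].
have mG : measurable G := mlabel_preimage [set w | w \notin A] (mlabel_word
  (n:=n)).
have mDG : measurable (lift_domain phi `&` G) by exact: measurableI.
have fG p : (lift_domain phi `&` G) p -> ln K <= f n p.
  rewrite lift_domainE => -[/= pL]; rewrite /G /= finset.in_set => /asboolP nA.
  have Kc : K < (word_count lam n (iter n Phi p).2)%:R.
    rewrite ltNge; apply/negP => h; apply: nA.
    by exists (iter n Phi p).2 => //; exact: iter_sub_word.
  rewrite /f overlap_countE ler_ln ?posrE//; [exact: ltW|exact: lt_trans Kc].
have mDGfin : mu (lift_domain phi `&` G) \is a fin_num
  by exact: fin_num_measure.
have h1 : ln K * fine (mu (lift_domain phi `&` G)) <= I n.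
  rewrite -lee_fin EFinM fineK// -integral_fin -(integral_cst mu mDG).
  apply: (@le_trans _ _ (\int[mu]_(p in lift_domain phi `&` G) (f n p)%:E)%E).
    by apply: ge0_le_integral => //=; exact: measurable_funS (mf_D n).
  by apply: ge0_subset_integral => //= p _; rewrite lee_fin.
have h2 : 1 <= fine (mu (lift_domain phi `&` G)) + fine (mu (~` G)).
  have := @fine_measure_leU _ _ _ mu _ _ _ mD mDG (measurableC mG).
  rewrite muD; apply=> p Dp.
  by have [Gp|nGp] := pselect (G p); [left|right].
have h3 : fine (mu (~` G)) <= 6 / n.+1%:R.
  rewrite (_ : ~` G = [set p | word n p \in A]); last first.
    by apply/seteqP; split => p; rewrite /G /=; [move/negP;
      rewrite negbK|move=> ->].
  rewrite uniform_words_tuple.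
  have := card_sparse_words_le lam0 lam1 n (ltW K0); rewrite -/A => hA.
  apply: (@le_trans _ _ (6 * (lam ^+ n)^-1 * K * 2^-1 ^+ n)).
    by rewrite ler_wpM2r// exprn_ge0.
  rewrite le_eqVlt; apply/orP; left; apply/eqP; rewrite /K exprMn exprVn.
  have ln0 : lam ^+ n != 0 by rewrite gt_eqF// exprn_gt0.
  have n0 : n.+1%:R != 0 :> R by rewrite pnatr_eq0.
  by field; rewrite ln0 expf_neq0 ?pnatr_eq0// nat1r n0.
(* ln K <= (n + 1) ln (2 lambda), and the factor n + 1 cancels. *)
have h4 : ln K * (6 / n.+1%:R) <= 6 * ln (2 * lam).
  rewrite mulrA ler_pdivrMr ?ltr0n// [_ * 6]mulrC -mulrA ler_pM2l//.
  have := ln_ge0 (_ : 1 <= n.+1%:R :> R); rewrite ler1n => /(_ isT) lnn.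
  by rewrite lnK -[X in _ <= _ * X]natr1 mulrDr mulr1 [ln _ * n%:R]mulrC lerD2l
    (le_trans _ (ltW l0))// oppr_le0.
have h5 : ln K * 1 <= ln K * (fine (mu (lift_domain phi `&` G)) + 6 / n.+1%:R).
  by rewrite ler_wpM2l// (le_trans h2)// lerD2l.
rewrite lerBlDr; move: h5; rewrite mulr1 mulrDr => /le_trans; apply.
exact: lerD.
Qed.

Lemma mean_log_overlap_cvg : mean_log_overlap phi mu @ \oo --> ln (2 * lam).
Proof.
have l0 : 0 < ln (2 * lam) by rewrite ln_gt0.
have [c hc] := overlap_integral_le.
apply: (@cvg_mean_linear _ I _ (Num.max (6 * ln (2 * lam)) c)) => n.
have := hc n; have := overlap_integral_ge n.
have m1 : 6 * ln (2 * lam) <= Num.max (6 * ln (2 * lam)) c by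
  rewrite le_max lexx.
have m2 : c <= Num.max (6 * ln (2 * lam)) c by rewrite le_max lexx orbT.
by move=> h1 h2; apply/andP; split; lra.
Qed.

End Overlap.

Theorem theorem1 (R : realType) (lambda : R)
    (hlambda : 2^-1 < lambda < 1)
    (hgarsia : garsia_number lambda^-1) :
  topological_overlap_number (bernoulli_ifs lambda) = 2 * lambda.
Proof.
have /andP[lam_half lam1] := hlambda.
have lam0 : 0 < lambda by apply: lt_trans lam_half.
have [nu [nuD nuinv nuw]] := bernoulli_product_measure_exists lam_half lam1.
pose phi_homo := bernoulli_ifs_homo lam_half.
pose phi_meas := bernoulli_ifs_measurable lambda.
have cvg_uniform mu := @mean_log_overlap_cvg R lambda lam_half lam1 hgarsia mu.
have expln : expR (ln (2 * lambda)) = 2 * lambda by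
  rewrite lnK// posrE mulr_gt0.
have nu_entropy := uniform_words_entropy phi_meas nuinv nuw.
rewrite /topological_overlap_number; set P := [set o | _].
(* [get] returns an element of P as soon as there is one: the product measure provides 2 lambda, and
   all elements of P are shown to equal it. *)
suff P_uniq o : P o -> o = 2 * lambda.
  apply: P_uniq; apply: (@getI _ P (2 * lambda)); exists nu; split.
    split => // mu _ muinv; apply: le_trans nu_entropy.
    exact: measure_entropy_le_card.
  by exists (ln (2 * lambda)); split => //; exact: cvg_uniform.
move=> [mu [[muD muinv mumax] [l [mu_l ->]]]].
(* By maximality mu has at least the entropy of [nu], that is at least ln 2, which forces
   equidistribution of its words. *)
have muw : uniform_words mu.
  apply: (entropy_uniform_words phi_homo phi_meas muinv).
  exact: le_trans nu_entropy (mumax nu nuD nuinv).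
by rewrite (cvg_unique _ mu_l (cvg_uniform mu muD muw)).
Qed.
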